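(* Let $\alpha\in(0,1)$ be given. Let $f$ be a log-concave density on $\mathbb{R}$ and suppose that $\log f$ is linear (i.e. affine) on some interval $J$ (so $J$ may be a proper subset of the support of $f$). Let $X_1,\dots,X_n$ be i.i.d. with density $f$, and let $\exp(\hat\ell)$ and $\exp(\hat\mu)$ be the lower and upper confidence bounds of level $1-\alpha$ for $f$ computed from $X_1,\dots,X_n$ as defined in the context. Then on every closed interval $I\subset\operatorname{int}J$, as $n\to\infty$, $$\Pr\nolimits_f\left\{\sup_{x\in I}\bigl|\exp(\hat\mu(x))-f(x)\bigr|\ \le\ C\sqrt{\frac{\log\log n}{n}}\right\}\ \to\ 1$$ for some constant $C$, and the same statement holds with $\exp(\hat\ell(x))$ in place of $\exp(\hat\mu(x))$. In particular, the width of the confidence band satisfies $$\max_{x\in I}\bigl(\exp(\hat\mu(x))-\exp(\hat\ell(x))\bigr)\ \le\ 2C\sqrt{\frac{\log\log n}{n}}$$ with probability converging to $1$.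
   Context: A density $f$ on $\mathbb{R}$ is log-concave if $f=\exp\phi$ with $\phi:\mathbb{R}\to[-\infty,\infty)$ concave. $\log$ is the natural logarithm, $\log_2$ the base-2 logarithm. $X_{(j)}$ is the $j$th order statistic of the sample. Definitions. $s_n:=\lceil\log_2\log n\rceil$; $m:=\lfloor (n-1)/2^{s_n}\rfloor+1$; $x_i:=X_{(1+(i-1)2^{s_n})}$ for $i=1,\dots,m$. $B_{max}:=\lfloor\log_2(n/8)\rfloor-s_n$. For $B=0,\dots,B_{max}$: $n_B:=\lfloor (n-1)/2^{B+s_n}\rfloor$ and $\mathcal{I}_B:=\{(j,k): j=1+(i-1)2^B,\ k=1+i2^B,\ i=1,\dots,n_B\}$. $t_n:=\sum_{B=0}^{B_{max}}\frac1{B+2}$. With $\mathrm{qBeta}(\gamma,r,s)$ the $\gamma$-quantile of the Beta$(r,s)$ distribution, $$c_B:=\mathrm{qBeta}\Bigl(\tfrac{\alpha}{2(B+2)n_Bt_n},2^{B+s_n},n+1-2^{B+s_n}\Bigr),\quad d_B:=\mathrm{qBeta}\Bigl(1-\tfrac{\alpha}{2(B+2)n_Bt_n},2^{B+s_n},n+1-2^{B+s_n}\Bigr).$$ $E(s):=\int_0^1 e^{st}\,dt$. For real vectors $\boldsymbol\ell=(\ell_1,\dots,\ell_m)$, $\boldsymbol g=(g_1,\dots,g_{m-1})$ and $i=1,\dots,m-1$: $\Lambda_i:=(x_{i+1}-x_i)e^{\ell_i}E(\ell_{i+1}-\ell_i)$; $U_i:=e^{\ell_i}(x_{i+1}-x_i)E(g_i(x_{i+1}-x_i))$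 if $i=m-1$, and $U_i:=e^{\ell_{i+1}}(x_{i+1}-x_i)E(g_{i+1}(x_i-x_{i+1}))$ if $1\le i\le m-2$; $V_i:=e^{\ell_i}(x_{i+1}-x_i)E(g_i(x_{i+1}-x_i))$ if $2\le i\le m-1$, and $V_i:=e^{\ell_{i+1}}(x_{i+1}-x_i)E(g_{i+1}(x_i-x_{i+1}))$ if $i=1$. Constraints on $(\boldsymbol\ell,\boldsymbol g)$: (C1) $\ell_j\le\ell_i+g_i(x_j-x_i)$ for all $i\in\{2,\dots,m-1\}$, $j\in\{i-1,i+1\}$; and for all $B=0,\dots,B_{max}$ and all $(j,k)\in\mathcal{I}_B$: (C2) $c_B\le\sum_{i=j}^{k-1}U_i$; (C3) $c_B\le\sum_{i=j}^{k-1}V_i$; (C4) $\sum_{i=j}^{k-1}\Lambda_i\le d_B$. For $i=1,\dots,m$ define $\hat\ell(x_i):=\min\ell_i$ and $\hat\mu(x_i):=\max\ell_i$, both subject to (C1)-(C4). These are extended to $\mathbb{R}$ as follows. Lower bound: $\hat\ell(x):=\hat\ell(x_i)+(x-x_i)\frac{\hat\ell(x_{i+1})-\hat\ell(x_i)}{x_{i+1}-x_i}$ for $x\in[x_i,x_{i+1})$, $i\in\{1,\dots,m-1\}$, and $\hat\ell(x):=-\infty$ otherwise. Upper bound: let $L_k:=\min_{1\le j\le k-1}\frac{\hat\mu(x_k)-\hat\ell(x_j)}{x_k-x_j}$ for $2\le k\le m$, $R_k:=\max_{k+1\le j\le m}\frac{\hat\ell(x_j)-\hat\mu(x_k)}{x_j-x_k}$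 for $1\le k\le m-1$, $x_0:=-\infty$, $x_{m+1}:=\infty$. Then $\hat\mu(x):=\hat\mu(x_{i+1})+R_{i+1}(x-x_{i+1})$ for $x\in(x_i,x_{i+1})$, $i\in\{0,1\}$; $\hat\mu(x):=\min\bigl(\hat\mu(x_i)+L_i(x-x_i),\ \hat\mu(x_{i+1})+R_{i+1}(x-x_{i+1})\bigr)$ for $x\in[x_i,x_{i+1})$, $i\in\{2,\dots,m-2\}$; $\hat\mu(x):=\hat\mu(x_i)+L_i(x-x_i)$ for $x\in[x_i,x_{i+1})$, $i\in\{m-1,m\}$.
   Formalization: On samples where no (ℓ,g) satisfies (C1)-(C4), an event whose probability need not vanish, the bounds are undefined; each limit is proved for the event ''if the constraints are feasible, then the stated inequality holds''. *)

(* Defs.v *)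
From HB Require Import structures.
From mathcomp Require Import all_boot all_order all_algebra.
From mathcomp Require Import all_classical all_reals all_analysis.

Set Implicit Arguments.
Unset Strict Implicit.
Unset Printing Implicit Defensive.
Import Order.TTheory GRing.Theory Num.Theory.
Import numFieldNormedType.Exports.
Local Open Scope classical_set_scope.
Local Open Scope ring_scope.

Section densities.
Context (R : realType).

Definition is_density (f : R -> R) : Prop :=
  [/\ measurable_fun setT f, (forall x, 0 <= f x) &
      (\int[lebesgue_measure]_x (f x)%:E = 1)%E].

(* In [\bar R], [0 * -oo = 0], so the end points t = 0 and t = 1 are
   harmless when [phi] takes the value [-oo]. *)
Definition concave_ereal (phi : R -> \bar R) : Prop :=
  forall (x y t : R), 0 <= t <= 1 ->
    (t%:E * phi x + (1 - t)%:E * phi y <= phi (t * x + (1 - t) * y)%R)%E.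

Definition log_concave (f : R -> R) : Prop :=
  exists phi : R -> \bar R,
    [/\ (forall x, (phi x < +oo)%E), concave_ereal phi &
        forall x, (f x)%:E = expeR (phi x)].

(* [lne 0 = -oo], so this forces f > 0 on J. *)
Definition log_affine_on (J : set R) (f : R -> R) : Prop :=
  exists p q : R, forall x, J x -> lne (f x)%:E = (p * x + q)%:E.

End densities.

Section sampling.
Context (d : measure_display) (T : measurableType d) (R : realType).
Context (P : probability T R).

(* Taking [A i = setT] for some of the [i < n] gives the product rule for every
   finite subfamily. *)
Definition mutually_independent (X : nat -> {RV P >-> R}) : Prop :=
  forall (n : nat) (A : nat -> set R), (forall i, measurable (A i)) ->
    P (\bigcap_(i < n) (X i @^-1` A i)) = (\prod_(i < n) P (X i @^-1` A i))%E.

Definition iid_with_density (f : R -> R) (X : nat -> {RV P >-> R}) : Prop :=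
  mutually_independent X /\
  forall (i : nat) (A : set R), measurable A ->
    distribution P (X i) A = (\int[lebesgue_measure]_(x in A) (f x)%:E)%E.

Definition sample (X : nat -> {RV P >-> R}) (n : nat) (w : T) : seq R :=
  mkseq (fun i => X i w) n.

(* [P E] is only meaningful for measurable [E]; the inner probability equals
   [P E] for those (lemma below) and makes sense for every event. *)
Definition inner_prob (E : set T) : \bar R :=
  ereal_sup [set P A | A in [set A | measurable A /\ A `<=` E]].

Lemma inner_prob_measurable (E : set T) : measurable E -> inner_prob E = P E.
Proof.
move=> mE; apply/eqP; rewrite eq_le; apply/andP; split.
  apply: ge_ereal_sup => _ [A [mA AE] <-].
  by apply: le_measure; rewrite ?inE //; exact: AE.
by apply: ereal_sup_ubound; exists E => //; split.
Qed.

Definition with_prob_tending_to_1 (E : nat -> set T) : Prop :=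
  inner_prob (E n) @[n --> \oo] --> 1%E.

End sampling.

Section tuning.
Context (R : realType).
Implicit Types (n B : nat) (alpha gamma s : R).

Definition log2 (x : R) : R := ln x / ln 2.

(* The ceiling is nonnegative for every n, so that [absz] changes nothing. *)
Definition s_ n : nat := `|Num.ceil (log2 (ln n%:R))|%N.

Definition m_ n : nat := (n.-1 %/ 2 ^ s_ n).+1.

(* Negative for small n, in which case there is no level B. *)
Definition Bmax n : int := Num.floor (log2 (n%:R / 8)) - (s_ n)%:Z.

Definition n_ n B : nat := (n.-1 %/ 2 ^ (B + s_ n))%N.

(* The bound B < n is implied by B <= Bmax n and only makes the sum finite. *)
Definition t_ n : R := \sum_(0 <= B < n | B%:Z <= Bmax n) (B + 2)%:R^-1.

Definition qBeta gamma (r s : nat) : R :=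
  inf [set x : R | (gamma%:E <= beta_prob (R := R) r s `]-oo, x])%E].

Definition level alpha n B : R :=
  alpha / (2 * (B + 2)%:R * (n_ n B)%:R * t_ n).

Definition c_ alpha n B : R :=
  qBeta (level alpha n B) (2 ^ (B + s_ n)) (n.+1 - 2 ^ (B + s_ n)).

Definition d_ alpha n B : R :=
  qBeta (1 - level alpha n B) (2 ^ (B + s_ n)) (n.+1 - 2 ^ (B + s_ n)).

Definition E_ s : R := \int[lebesgue_measure]_(t in `[0, 1]) expR (s * t).

End tuning.

Section band.
Context (R : realType) (alpha : R) (xs : seq R).
Implicit Types (i j k B : nat) (l g : nat -> R) (x : R).

Local Notation n := (size xs).
Local Notation s := (s_ R n).
Local Notation m := (m_ R n).

(* All indices are 1-based: [order_stat 1] is the sample minimum, and vectors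
   (l_1, ..., l_m), (g_1, ..., g_(m-1)) are functions on nat whose values
   outside 1, ..., m, resp. 1, ..., m-1, are irrelevant. *)
Definition order_stat j : R := nth 0 (sort <=%R xs) j.-1.

Definition node i : R := order_stat (1 + i.-1 * 2 ^ s).

Definition gap i : R := node i.+1 - node i.

Definition Lam l i : R := gap i * expR (l i) * E_ (l i.+1 - l i).

Definition fwd l g i : R := expR (l i) * gap i * E_ (g i * gap i).

Definition bwd l g i : R :=
  expR (l i.+1) * gap i * E_ (g i.+1 * (node i - node i.+1)).

Definition U_ l g i : R := if i == m.-1 then fwd l g i else bwd l g i.

Definition V_ l g i : R := if i == 1%N then bwd l g i else fwd l g i.

(* The pairs of $\mathcal{I}_B$ are (j, k) = (1 + (i-1) 2^B, 1 + i 2^B). *)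
Definition index_pairs B : set (nat * nat) :=
  [set jk | exists i, (1 <= i <= n_ R n B)%N /\
     jk = ((1 + i.-1 * 2 ^ B)%N, (1 + i * 2 ^ B)%N)].

Definition C1 l g : Prop := forall i j,
  (2 <= i <= m.-1)%N -> j = i.-1 \/ j = i.+1 ->
  l j <= l i + g i * (node j - node i).

Definition C2 l g : Prop := forall B j k,
  B%:Z <= Bmax R n -> index_pairs B (j, k) ->
  c_ alpha n B <= \sum_(j <= i < k) U_ l g i.

Definition C3 l g : Prop := forall B j k,
  B%:Z <= Bmax R n -> index_pairs B (j, k) ->
  c_ alpha n B <= \sum_(j <= i < k) V_ l g i.

Definition C4 l : Prop := forall B j k,
  B%:Z <= Bmax R n -> index_pairs B (j, k) ->
  \sum_(j <= i < k) Lam l i <= d_ alpha n B.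

Definition feasible : set ((nat -> R) * (nat -> R)) :=
  [set lg | [/\ C1 lg.1 lg.2, C2 lg.1 lg.2, C3 lg.1 lg.2 & C4 lg.1]].

(* For a log-concave density the constraints are infeasible with a probability
   that is at most [alpha] but need not vanish as n grows; the optimization
   problems, hence the confidence bounds, then have no value. *)
Definition band_exists : Prop := feasible !=set0.

(* The minima are taken in [\bar R]: no constraint bounds l_1 and l_m from
   below, so the minimum is [-oo] at i = 1 and i = m. *)
Definition lhat_node i : \bar R :=
  ereal_inf [set (lg.1 i)%:E | lg in feasible].

Definition muhat_node i : \bar R :=
  ereal_sup [set (lg.1 i)%:E | lg in feasible].

(* The number of nodes that are <= x, i.e. the i in 0, ..., m such that
   node i <= x < node i.+1, with the conventions node 0 = -oo and
   node m.+1 = +oo. *)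
Definition cell x : nat := count (fun i => node i <= x) (iota 1 m).

(* The conventions [-oo + +oo = -oo] and [0 * -oo = 0] of [\bar R] give the
   expected interpolation when one of the two node values is [-oo]: it is
   [-oo] except at a node with a finite value. *)
Definition lhat x : \bar R :=
  let i := cell x in
  if (1 <= i <= m.-1)%N then
    (lhat_node i + (x - node i)%:E *
       ((lhat_node i.+1 - lhat_node i) * ((gap i)^-1)%:E))%E
  else -oo%E.

Definition L_ k : \bar R :=
  \big[mine/+oo%E]_(1 <= j < k)
    ((muhat_node k - lhat_node j) * ((node k - node j)^-1)%:E)%E.

Definition R_ k : \bar R :=
  \big[maxe/-oo%E]_(k.+1 <= j < m.+1)
    ((lhat_node j - muhat_node k) * ((node j - node k)^-1)%:E)%E.

Definition muhat x : \bar R :=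
  let i := cell x in
  let from_left := (muhat_node i + L_ i * (x - node i)%:E)%E in
  let from_right := (muhat_node i.+1 + R_ i.+1 * (x - node i.+1)%:E)%E in
  if x == node 1 then muhat_node 1
  else if (i <= 1)%N then from_right
  else if (i <= m - 2)%N then mine from_left from_right
  else from_left.

End band.

(* Main.v *)
Require Import Defs.
From mathcomp Require Import all_boot all_order all_algebra.
From mathcomp Require Import all_classical all_reals all_analysis.
From mathcomp Require Import unstable measurable_realfun ring lra zify.
Import Order.TTheory GRing.Theory Num.Theory.
Import numFieldNormedType.Exports.
Local Open Scope classical_set_scope.
Local Open Scope ring_scope.

Set Implicit Arguments.
Unset Strict Implicit.

(** On a neighbourhood [a0, b0] of [a, b] the density is exp (lam x) with
    lam x = p x + q.  Put eta = sqrt (log log n / n); the claim is that l - lam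
    is O(eta) near [a, b] for every feasible (l, g), and that this carries over
    to the two bounds of the band.

    One coarse level suffices.  Among all the scales, take the one whose blocks
    hold N observations, with N / n between two constants 2 ^- (K + 1) and 2 ^- K,
    where K is so large that ten blocks fit into the mass of [a0, a] and into
    that of [b, b0].  There are boundedly many blocks at this level and the
    weights leave them a level of order (log n) ^ -2; as beta distributions have
    sub-Gaussian tails (XMonemX_shift_le), the critical values satisfy
    N / n - 5 eta <= c_ (c_ge) and d_ <= N / n + 5 eta (d_le).  This is where
    log log n comes from.  The true masses of the blocks are within 2 eta of
    N / n with probability 1 - O(1 / log log n): by Chebyshev's inequality the
    empirical distribution function is accurate at boundedly many fixed quantiles,
    and these enclose the random end points of the blocks (sample_quantiles).

    The rest is deterministic.  With th = O(eta), the constraint C4 says that the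
    integral of exp l over a block is at most about the true mass, so l <= lam + th
    at some node of each block (node_small).  The constraints C2 and C3 are about
    tangents and are only informative away from the mode of l - lam, but of two
    adjacent blocks one does not contain this mode, so l >= lam - th at some node
    of each pair of blocks (node_large).  Now l - lam is concave on the nodes.
    Between a pair of blocks on the left of [a, b] and one on the right it is
    therefore at least - th (feasible_lower).  From the left pair and a further
    block at a positive distance to the right of it, its slope further right is
    O(eta), hence so is l - lam from above (feasible_upper).

    The lower bound lhat interpolates affine functions up to th, so it inherits
    the estimate.  The extrapolation in muhat is above the interpolation of any
    feasible vector by concavity (muhat_lower); from above it is enough to look at
    the secant to one node on the left at a positive distance (muhat_upper).
    Concavity at the nodes requires them to be distinct, and indeed ties have
    probability 0 (iid_ties). *)

(** * Integrals of exponentials of affine functions *)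

Section chord.
Context {R : realType}.
Implicit Types (s u v x y p q th : R).
Local Notation mu := (@lebesgue_measure R).

(** The mean over [0, 1] of the exponential of the affine function that goes
    from u to v.  The quantities Lam, fwd and bwd are all of this form (they
    differ in the end values), and so is the mass that an exponential density
    gives to a cell; one monotonicity lemma then compares them. *)
Definition chord u v : R := expR u * E_ (v - u).

Lemma integrable_expR_affine u s :
  mu.-integrable `[0, 1] (EFin \o (fun t => expR (u + s * t))).
Proof.
apply: continuous_compact_integrable; first exact: segment_compact.
apply: continuous_subspaceT => x.
apply: (@continuous_comp _ _ _ (fun t => u + s * t) expR).
  by apply: cvgD; [exact: cvg_cst|apply: cvgM; [exact: cvg_cst|exact: cvg_id]].
exact: continuous_expR.
Qed.

Lemma chordE u v :
  chord u v = \int[mu]_(t in `[0, 1]) expR (u + (v - u) * t).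
Proof.
rewrite /chord /E_ -RintegralZl//.
  by apply: eq_Rintegral => t _; rewrite expRD.
apply: eq_integrable (integrable_expR_affine 0 (v - u)) => //.
by move=> t _ /=; rewrite add0r.
Qed.

Lemma chord_le u v u' v' : u <= u' -> v <= v' -> chord u v <= chord u' v'.
Proof.
move=> uu' vv'; rewrite !chordE; apply: le_Rintegral => //.
- exact: integrable_expR_affine.
- exact: integrable_expR_affine.
- move=> t /=; rewrite in_itv/= => /andP[t0 t1].
  rewrite ler_expR; nra.
Qed.

Lemma chordC u v : chord u v = chord v u.
Proof.
rewrite !chordE Rintegration_by_substitution_onem ?lexx ?ler01//.
  rewrite onem1; apply: eq_Rintegral => t _; congr expR; rewrite /onem; ring.
apply: continuous_subspaceT => x.
apply: (@continuous_comp _ _ _ (fun t => u + (v - u) * t) expR).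
  by apply: cvgD; [exact: cvg_cst|apply: cvgM; [exact: cvg_cst|exact: cvg_id]].
exact: continuous_expR.
Qed.

Lemma chordD th u v : chord (u + th) (v + th) = expR th * chord u v.
Proof.
by rewrite /chord expRD opprD addrACA subrr addr0 mulrCA mulrA.
Qed.

(** The substitution t = x + (y - x) * s carries [0, 1] to [x, y]. *)
Lemma integral_expR_affine p q x y : x < y ->
  (\int[mu]_(t in `[x, y]) (expR (p * t + q))%:E =
  ((y - x) * chord (p * x + q) (p * y + q))%:E)%E.
Proof.
move=> xy.
pose F t := x + (y - x) * t.
have DF t : is_derive t (1 : R) F (y - x).
  rewrite /F; apply: is_derive_eq; rewrite add0r mul1r; exact: mulr1.
have DF1 : F^`()%classic = cst (y - x).
  by apply/funext => u; rewrite derive1E derive_val.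
have F0 : F 0 = x by rewrite /F mulr0 addr0.
have F1 : F 1 = y by rewrite /F mulr1; ring.
have := @integration_by_substitution_increasing R F
  (fun t => expR (p * t + q)) 0 1 ler01.
rewrite F0 F1 DF1 => ->.
- rewrite chordE EFinM /Rintegral fineK//; last first.
    apply: integrable_fin_num => //; exact: integrable_expR_affine.
  rewrite -integralZl//; last exact: integrable_expR_affine.
  apply: eq_integral => t _ /=; rewrite -EFinM; congr EFin.
  rewrite /F /GRing.mul_fun/= mulrC; congr (_ * expR _); ring.
- by move=> t u _ _ tu; rewrite /F ltrD2l ltr_pM2l// subr_gt0.
- by move=> t _; exact: cst_continuous.
- exact: is_cvg_cst.
- exact: is_cvg_cst.
- have cF : continuous F.
    by move=> t; apply/differentiable_continuous/derivable1_diffP; case: (DF t).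
  split; first by move=> t _; case: (DF t).
    exact/cvg_at_right_filter/cF.
  exact/cvg_at_left_filter/cF.
- apply: continuous_subspaceT => t.
  apply: (@continuous_comp _ _ _ (fun t => p * t + q) expR).
    by apply: cvgD; [apply: cvgM; [exact: cvg_cst|exact: cvg_id]|exact: cvg_cst].
  exact: continuous_expR.
Qed.

End chord.

(** * Concave sequences at the nodes *)

Section concave_sequence.
Context {R : realType}.
Variables (x l g : nat -> R) (m : nat).
Hypothesis x_incr : forall i, (1 <= i < m)%N -> x i < x i.+1.
Hypothesis tangent_nbr : forall i j, (2 <= i <= m.-1)%N -> j = i.-1 \/ j = i.+1 ->
  l j <= l i + g i * (x j - x i).

Lemma incr_seq_le i j : (1 <= i)%N -> (i <= j)%N -> (j <= m)%N -> x i <= x j.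
Proof.
move=> i1 ij; elim: j ij => [|j IH]; first by rewrite leqn0 => /eqP ->.
rewrite leq_eqVlt => /predU1P[-> //|]; rewrite ltnS => ij jm.
apply: (le_trans (IH ij (ltnW jm))); apply/ltW/x_incr; lia.
Qed.

(** Both neighbours use the common cell: the tangent at i bounds its secant from
    above by g i, the one at i.+1 from below by g i.+1.  A tied cell would give
    no relation, which is why the nodes have to be distinct. *)
Lemma slope_step i : (2 <= i)%N -> (i.+1 <= m.-1)%N -> g i.+1 <= g i.
Proof.
move=> i2 im.
have xi : 0 < x i.+1 - x i by rewrite subr_gt0; apply: x_incr; lia.
have A : l i.+1 <= l i + g i * (x i.+1 - x i).
  by apply: tangent_nbr; [lia|right].
have B : l i <= l i.+1 + g i.+1 * (x i - x i.+1).
  by apply: tangent_nbr; [lia|left].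
rewrite -(ler_pM2r xi); nra.
Qed.

Lemma slope_noninc i j : (2 <= i)%N -> (i <= j)%N -> (j <= m.-1)%N -> g j <= g i.
Proof.
move=> i2 ij; elim: j ij => [|j IH]; first by rewrite leqn0 => /eqP ->.
rewrite leq_eqVlt => /predU1P[-> //|]; rewrite ltnS => ij jm.
apply: le_trans (IH ij (ltnW jm)); apply: slope_step; lia.
Qed.

Lemma tangent_right i j : (2 <= i <= m.-1)%N -> (i <= j)%N -> (j <= m)%N ->
  l j <= l i + g i * (x j - x i).
Proof.
move=> im; elim: j => [|j IH]; first by lia.
rewrite leq_eqVlt => /predU1P[<- _|]; first by rewrite subrr mulr0 addr0.
rewrite ltnS => ij jm.
have lj := IH ij (ltnW jm).
have lj1 : l j.+1 <= l j + g j * (x j.+1 - x j).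
  by apply: tangent_nbr; [lia|right].
have gj : g j <= g i by apply: slope_noninc; lia.
have xj : x j < x j.+1 by apply: x_incr; lia.
nra.
Qed.

Lemma tangent_left i j : (2 <= i <= m.-1)%N -> (1 <= j)%N -> (j <= i)%N ->
  l j <= l i + g i * (x j - x i).
Proof.
move=> im j1 ji; rewrite -(subKn ji).
have : (i - j <= i.-1)%N by lia.
elim: (i - j)%N => [_|k IH ki]; first by rewrite subn0 subrr mulr0 addr0.
have lk := IH (ltnW ki).
set u := (i - k)%N in lk *.
have -> : (i - k.+1)%N = u.-1 by rewrite /u; lia.
have lk1 : l u.-1 <= l u + g u * (x u.-1 - x u).
  by apply: tangent_nbr; [rewrite /u; lia|left].
have gu : g i <= g u by apply: slope_noninc; rewrite /u; lia.
have xu : x u.-1 < x u.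
  by have := @x_incr u.-1; rewrite prednK; [apply; rewrite /u; lia|rewrite /u; lia].
nra.
Qed.

(** The constraint C1 only compares neighbouring nodes; since the slopes
    decrease, it propagates to all the nodes. *)
Lemma tangent i j : (2 <= i <= m.-1)%N -> (1 <= j <= m)%N ->
  l j <= l i + g i * (x j - x i).
Proof.
move=> im /andP[j1 jm]; case: (leqP i j) => ij.
  exact: tangent_right.
exact: tangent_left (ltnW ij).
Qed.

Variables p q : R.
Let lam i := p * x i + q.
Let dx i := x i.+1 - x i.
Let Lm i := dx i * chord (l i) (l i.+1).
Let bw i := dx i * chord (l i.+1) (l i.+1 - g i.+1 * dx i).
Let fw i := dx i * chord (l i) (l i + g i * dx i).
Let mass i := dx i * chord (lam i) (lam i.+1).

(** If l were above lam + th at all the nodes of a block, so would be the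
    interpolation of l, and its integral would exceed the upper bound d. *)
Lemma node_small j k (th d : R) : (1 <= j)%N -> (j < k)%N -> (k <= m)%N ->
  \sum_(j <= i < k) Lm i <= d -> d < expR th * (\sum_(j <= i < k) mass i) ->
  exists2 z, (j <= z <= k)%N & l z <= lam z + th.
Proof.
move=> j1 jk km Ld dm; apply: contrapT => H.
have big z : (j <= z <= k)%N -> lam z + th <= l z.
  move=> zjk; case: (lerP (l z) (lam z + th)) => [lz|/ltW//].
  by exfalso; apply: H; exists z.
suff : expR th * (\sum_(j <= i < k) mass i) <= \sum_(j <= i < k) Lm i.
  by move=> /le_trans/(_ Ld); rewrite leNgt dm.
rewrite mulr_sumr big_nat_cond [leRHS]big_nat_cond.
apply: ler_sum => i; rewrite andbT => ijk.
rewrite /mass mulrCA -chordD ler_wpM2l//.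
  by rewrite subr_ge0; apply/ltW/x_incr; lia.
by apply: chord_le; apply: big; lia.
Qed.

(** The lower constraints bound the integrals of tangents, not of l itself, so
    that a single block may carry enough mass although l is small at all of its
    nodes.  This can only happen in the block that contains the mode of l - lam.
    Of two adjacent blocks one is free of it: with g k >= p at the common
    end point k, the tangents extended to the left on the first block stay below
    lam - th as soon as l does; with g k < p, those extended to the right on the
    second block do. *)
Lemma node_large j k r (th c : R) : (2 <= j)%N -> (j < k)%N -> (k < r)%N ->
  (r <= m.-1)%N ->
  c <= \sum_(j <= i < k) bw i -> expR (- th) * (\sum_(j <= i < k) mass i) < c ->
  c <= \sum_(k <= i < r) fw i -> expR (- th) * (\sum_(k <= i < r) mass i) < c ->
  exists2 w, (j <= w <= r)%N & lam w - th <= l w.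
Proof.
move=> j2 jk kr rm cbw mbw cfw mfw; apply: contrapT => H.
have small w : (j <= w <= r)%N -> l w <= lam w - th.
  move=> wjk; case: (lerP (lam w - th) (l w)) => [lw|/ltW//].
  by exfalso; apply: H; exists w.
have [gk|gk] := leP p (g k).
  suff : \sum_(j <= i < k) bw i <= expR (- th) * (\sum_(j <= i < k) mass i).
    by move=> /(le_trans cbw); rewrite leNgt mbw.
  rewrite mulr_sumr big_nat_cond [leRHS]big_nat_cond.
  apply: ler_sum => i; rewrite andbT => ijk.
  have dx0 : 0 < dx i by rewrite subr_gt0; apply/x_incr; lia.
  rewrite /mass mulrCA -chordD ler_wpM2l ?(ltW dx0)// chordC.
  have gi : g k <= g i.+1 by apply: slope_noninc; lia.
  have li : l i.+1 <= lam i.+1 - th by apply: small; lia.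
  have -> : lam i - th = (lam i.+1 - th) - p * dx i by rewrite /lam /dx; ring.
  by apply: chord_le => //; rewrite lerB// ler_wpM2r ?(ltW dx0)// (le_trans gk gi).
suff : \sum_(k <= i < r) fw i <= expR (- th) * (\sum_(k <= i < r) mass i).
  by move=> /(le_trans cfw); rewrite leNgt mfw.
rewrite mulr_sumr big_nat_cond [leRHS]big_nat_cond.
apply: ler_sum => i; rewrite andbT => ijk.
have dx0 : 0 < dx i by rewrite subr_gt0; apply/x_incr; lia.
rewrite /mass mulrCA -chordD ler_wpM2l ?(ltW dx0)//.
have gi : g i <= g k by apply: slope_noninc; lia.
have li : l i <= lam i - th by apply: small; lia.
have -> : lam i.+1 - th = (lam i - th) + p * dx i by rewrite /lam /dx; ring.
by apply: chord_le => //; rewrite lerD// ler_wpM2r ?(ltW dx0)// (le_trans gi (ltW gk)).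
Qed.

(** Relative to lam, the tangent at i does not increase towards w if g i >= p,
    and towards w' otherwise; so l - lam cannot be smaller at i than at both w
    and w'. *)
Lemma ge_between w i w' th : (1 <= w)%N -> (w <= i <= w')%N -> (w' <= m)%N ->
  (2 <= i <= m.-1)%N ->
  lam w - th <= l w -> lam w' - th <= l w' -> lam i - th <= l i.
Proof.
move=> w1 /andP[wi iw'] w'm im lw lw'.
have A : l w <= l i + g i * (x w - x i) by apply: tangent => //; lia.
have B : l w' <= l i + g i * (x w' - x i) by apply: tangent => //; lia.
have xw : x w <= x i by apply: incr_seq_le; lia.
have xw' : x i <= x w' by apply: incr_seq_le; lia.
rewrite /lam in lw lw' *; have [gp|/ltW gp] := leP p (g i); nra.
Qed.

(** The concave function l - lam is at least - th at w and at most th at z,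
    further right by at least rho: from z on its slope is at most 2 * th / rho. *)
Lemma le_extrapolate w z i th rho W : (1 <= w <= m)%N -> (2 <= z <= m.-1)%N ->
  (z <= i <= m)%N -> 0 <= th -> 0 < rho -> rho <= x z - x w -> x i - x z <= W ->
  lam w - th <= l w -> l z <= lam z + th ->
  l i <= lam i + th * (1 + 2 * W / rho).
Proof.
move=> wm zm /andP[zi im] th0 rho0 rhozw xW lw lz.
have xzi : x z <= x i by apply: incr_seq_le; lia.
have A : l w <= l z + g z * (x w - x z) by apply: tangent.
have B : l i <= l z + g z * (x i - x z) by apply: tangent => //; lia.
have gz : (g z - p) * rho <= 2 * th.
  have [gp|gp] := leP p (g z); last by nra.
  by rewrite /lam in lw lz; nra.
have gz' : g z - p <= 2 * th / rho by rewrite ler_pdivlMr.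
have th2 : 0 <= 2 * th / rho by apply: divr_ge0; [lra|exact: ltW].
have -> : th * (1 + 2 * W / rho) = th + 2 * th / rho * W by ring.
by rewrite /lam in lz *; nra.
Qed.

End concave_sequence.

(** * Sub-Gaussian tails and quantiles of beta distributions *)

Section beta_tails.
Context {R : realType}.
Implicit Types (a b : nat) (x y z t : R).
Local Notation mu := (@lebesgue_measure R).

(** Apply 1 + u <= exp u to both factors: y - t = y * (1 - t / y) and
    1 - (y - t) = (1 - y) * (1 + t / (1 - y)). *)
Lemma XMonemX_shift a b y t : 0 < y < 1 -> 0 <= y - t <= 1 ->
  XMonemX a b (y - t) <=
  expR (- (t * ((a%:R * (1 - y) - b%:R * y) / (y * (1 - y))))) * XMonemX a b y.
Proof.
move=> /andP[y0 y1] /andP[yt0 yt1]; rewrite /XMonemX /unstable.onem.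
have y1' : 0 < 1 - y by lra.
have A : y - t <= y * expR (- (t / y)).
  apply: le_trans (ler_wpM2l (ltW y0) (expR_ge1Dx _)).
  by rewrite mulrDr mulr1 mulrN mulrCA divff ?mulr1// gt_eqF.
have B : 1 - (y - t) <= (1 - y) * expR (t / (1 - y)).
  apply: le_trans (ler_wpM2l (ltW y1') (expR_ge1Dx _)).
  rewrite mulrDr mulr1 mulrCA divff ?mulr1 ?gt_eqF//; lra.
apply: (@le_trans _ _
  ((y * expR (- (t / y))) ^+ a * ((1 - y) * expR (t / (1 - y))) ^+ b)).
  apply: ler_pM; rewrite ?exprn_ge0//; first by lra.
    by apply: lerXn2r; rewrite ?nnegrE// mulr_ge0 ?expR_ge0// ltW.
  by apply: lerXn2r; rewrite ?nnegrE//; [lra|rewrite mulr_ge0 ?expR_ge0// ltW].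
rewrite !exprMn -!expRM_natl mulrACA -expRD mulrC.
rewrite le_eqVlt; apply/orP; left; apply/eqP; congr (expR _ * _).
by field; rewrite !gt_eqF.
Qed.

(** Left of the mode a / (a + b) by 2 * t, moving by t towards it multiplies the
    beta density by at least exp ((a + b) * t ^ 2).  The same factor then bounds
    a whole tail by a translate of it, which has mass at most one: this gives a
    sub-Gaussian tail without any normalizing constant. *)
Lemma XMonemX_shift_le a b x t : 0 <= x -> 0 < t ->
  (x + 2 * t) * (a + b)%:R <= a%:R -> (0 < a + b)%N ->
  XMonemX a b x <= expR (- ((a + b)%:R * t ^+ 2)) * XMonemX a b (x + t).
Proof.
move=> x0 t0 xt ab.
have ab0 : 0 < (a + b)%:R :> R by rewrite ltr0n.
have xt1 : x + 2 * t <= 1.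
  rewrite -(ler_pM2r ab0) mul1r (le_trans xt)// ler_nat; exact: leq_addr.
have y0 : 0 < x + t by lra.
have y1 : 0 < 1 - (x + t) by lra.
have := @XMonemX_shift a b (x + t) t; rewrite addrK => /(_ _ _)/le_trans; apply.
- by lra.
- by lra.
apply: ler_wpM2r; first by apply: XMonemX_ge0; rewrite in_itv/=; lra.
rewrite ler_expR lerN2 expr2 mulrCA ler_pM2l//.
rewrite ler_pdivlMr ?mulr_gt0//.
rewrite natrD in ab0 xt *.
have Q : 0 <= 1 - (x + t) * (1 - (x + t)) by nra.
have : 0 <= (a%:R + b%:R) * t * (1 - (x + t) * (1 - (x + t))).
  by apply: mulr_ge0 => //; apply: mulr_ge0; exact: ltW.
nra.
Qed.

Local Open Scope ereal_scope.

Lemma integral_XMonemX_shift a b z t : (0 <= z)%R -> (0 < t)%R ->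
  ((z + 2 * t) * (a + b)%:R <= a%:R)%R -> (0 < a + b)%N ->
  \int[mu]_(x in `[0%R, z]) (XMonemX a b x)%:E <=
  (expR (- ((a + b)%:R * t ^+ 2)) * beta_fun a.+1 b.+1)%:E.
Proof.
move=> z0 t0 zt ab.
have ab0 : (0 < (a + b)%:R :> R)%R by rewrite ltr0n.
have zt1 : (z + 2 * t <= 1)%R.
  rewrite -(ler_pM2r ab0) mul1r (le_trans zt)// ler_nat; exact: leq_addr.
have XM0 (x : R) : (0 <= x <= 1)%R -> 0 <= (XMonemX a b x)%:E.
  by move=> x01; rewrite lee_fin XMonemX_ge0.
have mX : measurable_fun [set: R] (EFin \o XMonemX a b).
  by apply/measurable_EFinP; exact: measurable_XMonemX.
have mXt : measurable_fun [set: R] (EFin \o (fun x : R => XMonemX a b (x + t))).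
  apply/measurable_EFinP; apply: continuous_measurable_fun => x.
  apply: (@continuous_comp _ _ _ (fun x => x + t)%R (XMonemX a b)).
    by apply: cvgD; [exact: cvg_id|exact: cvg_cst].
  exact: continuous_XMonemX.
pose e := expR (- ((a + b)%:R * t ^+ 2)).
apply: (@le_trans _ _ (\int[mu]_(x in `[0%R, z]) (e%:E * (XMonemX a b (x + t))%:E))).
  apply: ge0_le_integral => //=.
  - by move=> x; rewrite in_itv/= => xz; apply: XM0; lra.
  - exact: measurable_funTS.
  - by apply: measurable_funeM; exact: measurable_funTS.
  - move=> x; rewrite in_itv/= => xz; rewrite -EFinM lee_fin.
    apply: XMonemX_shift_le => //; first by lra.
    by apply: le_trans zt; rewrite ler_wpM2r ?ler0n//; lra.
rewrite ge0_integralZl_EFin//=; first last.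
- exact: expR_ge0.
- exact: measurable_funTS.
- by move=> x; rewrite in_itv/= => xz; apply: XM0; lra.
rewrite EFinM lee_pmul2l ?fin_numE// ?lte_fin ?expR_gt0//.
rewrite EFin_beta_fun/=.
have <- : \int[mu]_(x in `[(0 + t)%R, (z + t)%R]) (XMonemX a b x)%:E =
   \int[mu]_(x in `[0%R, z]) (XMonemX a b (x + t))%:E.
  have D u : is_derive u (1%R : R) (fun v : R => v + t)%R 1%R.
    by apply: is_derive_eq; rewrite addr0.
  have D1 : ((fun v : R => v + t)^`()%classic = cst 1)%R.
    by apply/funext => u; rewrite derive1E derive_val.
  rewrite (@integration_by_substitution_increasing R (fun u => u + t)%R _ 0%R z z0)//.
  - by apply: eq_integral => u _ /=; rewrite /GRing.mul_fun/= D1 /= mulr1.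
  - by move=> u v _ _ uv; rewrite ltrD2r.
  - by rewrite D1 => u _; exact: cst_continuous.
  - by rewrite D1; exact: is_cvg_cst.
  - by rewrite D1; exact: is_cvg_cst.
  - have cF : continuous (fun v : R => v + t)%R.
      by move=> u; apply/differentiable_continuous/derivable1_diffP; case: (D u).
    split; first by move=> u _; case: (D u).
      exact/cvg_at_right_filter/cF.
    exact/cvg_at_left_filter/cF.
  - exact: within_continuous_XMonemX.
rewrite integral_XMonemX_restrict setTI.
apply: ge0_subset_integral => //=.
- exact: measurable_funTS.
- by move=> x /=; rewrite !in_itv/= => xz; lra.
Qed.

Lemma beta_probE a b (U : set R) : measurable U ->
  beta_prob (R := R) a.+1 b.+1 U =
  (\int[mu]_(x in U `&` `[0%R, 1%R]) (XMonemX a b x)%:E) *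
  ((beta_fun a.+1 b.+1 : R)^-1)%:E.
Proof.
move=> mU; rewrite -[LHS]integral_beta_pdf// /beta_pdf -integral_XMonemX_restrict.
under eq_integral do rewrite EFinM/=.
rewrite ge0_integralZr//=.
- apply/measurable_funTS/measurableT_comp => //.
  by apply/measurable_restrict => //=; rewrite setTI; exact: measurable_XMonemX.
- move=> x Ux; rewrite patchE; case: ifPn => //; rewrite inE/= => x01.
  by rewrite lee_fin XMonemX_ge0.
- by rewrite lee_fin invr_ge0// beta_fun_ge0.
Qed.

(** The mode of the beta (a.+1, b.+1) density is a / (a + b), and 2 * t is the
    distance from z to it. *)
Lemma beta_lower_tail a b z t : (0 <= z)%R -> (0 < t)%R ->
  ((z + 2 * t) * (a + b)%:R <= a%:R)%R -> (0 < a + b)%N ->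
  beta_prob (R := R) a.+1 b.+1 `]-oo, z] <= (expR (- ((a + b)%:R * t ^+ 2)))%:E.
Proof.
move=> z0 t0 zt ab.
have ab0 : (0 < (a + b)%:R :> R)%R by rewrite ltr0n.
have zt1 : (z + 2 * t <= 1)%R.
  rewrite -(ler_pM2r ab0) mul1r (le_trans zt)// ler_nat; exact: leq_addr.
have bf0 : (0 < beta_fun a.+1 b.+1 :> R)%R by exact: beta_fun_gt0.
rewrite beta_probE// lee_pdivrMr// -EFinM.
have -> : `]-oo, z] `&` `[0%R, 1%R] = `[0%R, z]%classic.
  by apply/seteqP; split => x /=; rewrite !in_itv/=; [case=> *; lra|move=> *; split; lra].
exact: integral_XMonemX_shift.
Qed.

(** The reflection x |-> 1 - x exchanges the two tails and a with b. *)
Lemma beta_upper_tail a b z t : (z <= 1)%R -> (0 < t)%R ->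
  (a%:R <= (z - 2 * t) * (a + b)%:R)%R -> (0 < a + b)%N ->
  1 - (expR (- ((a + b)%:R * t ^+ 2)))%:E <= beta_prob (R := R) a.+1 b.+1 `]-oo, z].
Proof.
move=> z1 t0 zt ab.
have ab0 : (0 < (a + b)%:R :> R)%R by rewrite ltr0n.
have a0 : (0 <= a%:R :> R)%R by rewrite ler0n.
have zt1 : (0 <= z - 2 * t)%R.
  by rewrite -(ler_pM2r ab0) mul0r (le_trans _ zt).
have bf0 : (0 < beta_fun b.+1 a.+1 :> R)%R by exact: beta_fun_gt0.
have -> : `]-oo, z]%classic = ~` `]z, +oo[%classic :> set R by rewrite setCitvr.
rewrite probability_setC//.
apply: leeB => //.
change (beta_prob (R := R) a.+1 b.+1 `]z, +oo[ <=
  (expR (- ((a + b)%:R * t ^+ 2)))%:E).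
rewrite beta_probE// beta_fun_sym lee_pdivrMr// -EFinM.
have := @integral_XMonemX_shift b a (1 - z)%R t.
rewrite addnC => H; apply: le_trans (H _ _ _ _) => //; last 2 first.
- by rewrite natrD in zt ab0 *; nra.
- by lra.
have r01 : (0 <= 1 - z <= 1)%R by lra.
rewrite (@integration_by_substitution_onem _ (XMonemX b a) _ r01); last first.
  exact: within_continuous_XMonemX.
have -> : (1 - z).~ = z by rewrite /onem; lra.
under [leRHS]eq_integral do rewrite XMonemXC.
apply: ge0_subset_integral => //=.
- exact: measurableI.
- by apply/measurable_funTS/measurable_EFinP; exact: measurable_XMonemX.
- by move=> x; rewrite in_itv/= => xz; rewrite lee_fin XMonemX_ge0// in_itv/=; lra.
- by move=> x /=; rewrite !in_itv/= => -[] *; lra.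
Qed.

Local Close Scope ereal_scope.

Lemma qBeta_ge gam a b z t : 0 <= z -> 0 < t ->
  (z + 2 * t) * (a + b)%:R <= a%:R -> (0 < a + b)%N ->
  expR (- ((a + b)%:R * t ^+ 2)) < gam -> gam <= 1 ->
  z <= qBeta gam a.+1 b.+1.
Proof.
move=> z0 t0 zt ab egam gam1; apply: lb_le_inf.
  exists 1 => /=; apply: (@le_trans _ _ 1%E); first by rewrite lee_fin.
  rewrite -(beta_prob01 a.+1 b.+1); apply: le_measure; rewrite ?inE//.
  by move=> x /=; rewrite !in_itv/= => /andP[].
move=> x /= gx; rewrite leNgt; apply/negP => xz.
have : (beta_prob (R := R) a.+1 b.+1 `]-oo, x] <=
        beta_prob (R := R) a.+1 b.+1 `]-oo, z])%E.
  apply: le_measure; rewrite ?inE// => y /=; rewrite !in_itv/=; lra.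
move=> /(le_trans gx)/le_trans/(_ (beta_lower_tail z0 t0 zt ab)).
rewrite lee_fin; lra.
Qed.

Lemma qBeta_le gam a b z t : z <= 1 -> 0 < t ->
  a%:R <= (z - 2 * t) * (a + b)%:R -> (0 < a + b)%N ->
  expR (- ((a + b)%:R * t ^+ 2)) <= 1 - gam -> 0 < gam ->
  qBeta gam a.+1 b.+1 <= z.
Proof.
move=> z1 t0 zt ab egam gam0; apply: ge_inf.
  exists 0 => x /= gx; rewrite leNgt; apply/negP => x0.
  suff E : beta_prob (R := R) a.+1 b.+1 `]-oo, x] = 0%E.
    by move: gx; rewrite E lee_fin; lra.
  rewrite beta_probE// (_ : _ `&` _ = set0) ?integral_set0 ?mul0e//.
  by apply/seteqP; split => // y /=; rewrite !in_itv/=; lra.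
apply: le_trans (beta_upper_tail z1 t0 zt ab).
by rewrite -EFinB lee_fin; lra.
Qed.

End beta_tails.

(** * Counts of independent events and ties in an i.i.d. sample *)

Section pairwise_independent_events.
Context d (T : measurableType d) (R : realType) (P : probability T R).
Variables (A : nat -> set T) (p : R).
Hypothesis mA : forall i, measurable (A i).
Hypothesis PA : forall i, P (A i) = p%:E.
Hypothesis indepA : forall i j, i != j ->
  P (A i `&` A j) = (P (A i) * P (A j))%E.

Let I i : T -> R := \1_(A i).
Let S n : T -> R := fun w => \sum_(i < n) I i w.

Let p01 : 0 <= p <= 1.
Proof. by rewrite -!lee_fin -(PA 0) measure_ge0 probability_le1. Qed.

Let I2 i : I i \in Lfun P 2%:E.
Proof.
rewrite inE; apply/andP; split; rewrite inE/=.
  exact: measurable_indic.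
rewrite /finite_norm unlock poweR_lty//.
apply: (@le_lt_trans _ _ (\int[P]_x (cst 1%E x))%E).
  apply: ge0_le_integral => //.
  - by move=> x _; rewrite lee_fin powR_ge0.
  - apply/measurable_EFinP; apply: (measurableT_comp (measurable_powR _)) => //.
    by apply: measurableT_comp => //; exact: measurable_indic.
  - move=> x _; rewrite lee_fin /I indicE; case: (x \in A i).
      by rewrite normr1 powR1.
    by rewrite normr0 powR0//; exact: ler01.
by rewrite integral_cst// mul1e (le_lt_trans (probability_le1 P measurableT))// ltry.
Qed.

Let S2 n : S n \in Lfun P 2%:E.
Proof.
elim: n => [|n IH].
  have -> : S 0 = cst 0 by apply/funext => w; rewrite /S big_ord0.
  exact: Lfun_cst.
have -> : S n.+1 = S n + I n.
  by apply/funext => w; rewrite /S big_ord_recr.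
by rewrite rpredD// ?lee1n.
Qed.

(* Uncorrelated indicators: the variance of the count is additive. *)
Let cov_I i j : covariance P (I i) (I j) = if i == j then (p - p ^+ 2)%:E else 0%E.
Proof.
have Pfin : P setT \is a fin_num := fin_num_measure P _ measurableT.
rewrite covarianceE ?Lfun2_mul_Lfun1//; [|exact: Lfun_subset12|exact: Lfun_subset12].
have -> : (I i * I j)%R = \1_(A i `&` A j) by rewrite /I indicI.
rewrite !expectation_indic//; last exact: measurableI.
case: eqP => [->|/eqP ij]; first by rewrite setIid !PA -EFinM -EFinB expr2.
by rewrite indepA// !PA subee.
Qed.

Let cov_S n k : (n <= k)%N -> covariance P (S n) (I k) = 0%E.
Proof.
elim: n => [|n IH] nk.
  have -> : S 0 = cst 0 by apply/funext => w; rewrite /S big_ord0.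
  exact: covariance_cst_l.
have -> : S n.+1 = S n \+ I n.
  by apply/funext => w; rewrite /S big_ord_recr.
by rewrite covarianceDl// IH ?(ltnW nk)// cov_I ltn_eqF// adde0.
Qed.

Let var_S n : 'V_P[S n] = (n%:R * (p - p ^+ 2))%:E.
Proof.
elim: n => [|n IH].
  have -> : S 0 = cst 0 by apply/funext => w; rewrite /S big_ord0.
  by rewrite variance_cst mul0r.
have -> : S n.+1 = S n \+ I n.
  by apply/funext => w; rewrite /S big_ord_recr.
rewrite varianceD// IH cov_S// mule0 adde0 /variance cov_I eqxx -EFinD.
by rewrite -natr1 mulrDl mul1r.
Qed.

Let exp_S n : expectation P (S n) = (n%:R * p)%:E.
Proof.
have Pfin : P setT \is a fin_num := fin_num_measure P _ measurableT.
elim: n => [|n IH].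
  have -> : S 0 = cst 0 by apply/funext => w; rewrite /S big_ord0.
  by rewrite expectation_cst mul0r.
have -> : S n.+1 = S n \+ I n.
  by apply/funext => w; rewrite /S big_ord_recr.
rewrite expectationD; [|exact: Lfun_subset12|exact: Lfun_subset12].
by rewrite IH expectation_indic// PA -EFinD -natr1 mulrDl mul1r.
Qed.

(** The variance is n * p * (1 - p) <= n / 4. *)
Lemma chebyshev_count n (t : R) : 0 < t ->
  (P [set w | (t <= `|\sum_(i < n) \1_(A i) w - n%:R * p|)%R] <=
  (n%:R / (4 * t ^+ 2))%:E)%E.
Proof.
move=> t0.
have mS : measurable_fun [set: T] (S n).
  by apply: measurable_sum => i; exact: measurable_indic.
pose Y : {RV P >-> R} := mfun_Sub (mem_set mS).
have := chebyshev Y t0; rewrite /= exp_S var_S /= => /le_trans; apply.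
have -> : n%:R / (4 * t ^+ 2) = t ^- 2 * (n%:R / 4) by field; rewrite gt_eqF.
rewrite -EFinM lee_fin ler_pM2l ?invr_gt0 ?exprn_gt0//.
rewrite ler_wpM2l//; have /andP[? ?] := p01.
have : 0 <= (2 * p - 1) ^+ 2 by exact: sqr_ge0.
rewrite !expr2; lra.
Qed.

End pairwise_independent_events.

Section iid_sample.
Context d (T : measurableType d) (R : realType) (P : probability T R).
Variables (f : R -> R) (X : nat -> {RV P >-> R}).
Hypothesis iidX : iid_with_density f X.

(** Independence of two of the variables is the product rule with the whole
    line in all the other coordinates. *)
Lemma iid_pair i j (A B : set R) : i != j -> measurable A -> measurable B ->
  P (X i @^-1` A `&` X j @^-1` B) = (P (X i @^-1` A) * P (X j @^-1` B))%E.
Proof.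
move=> ij mA mB.
pose C k := if k == i then A else if k == j then B else setT.
have mC k : measurable (C k) by rewrite /C; case: ifP => // _; case: ifP.
have Ci : C i = A by rewrite /C eqxx.
have Cj : C j = B by rewrite /C eq_sym (negPf ij) eqxx.
pose n := (maxn i j).+1.
have [ilt jlt] : (i < n)%N /\ (j < n)%N.
  by rewrite /n !ltnS leq_maxl leq_maxr.
have := iidX.1 n C mC.
rewrite (bigD1 (Ordinal ilt))//= (bigD1 (Ordinal jlt))/=; last first.
  by apply: contra ij => /eqP/(congr1 val)/= ->.
rewrite big1 => [|k /andP[ki kj]].
  rewrite mule1 Ci Cj => <-; congr (P _); apply/seteqP; split => w /=.
    by move=> [Aw Bw] k /= _; rewrite /C; case: eqP => [->//|_]; case: eqP => [->|].
  by move=> H; split; [rewrite -Ci|rewrite -Cj]; exact: H.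
have -> : C k = setT.
  by rewrite /C !ifN.
by rewrite preimage_setT probability_setT.
Qed.

(** By independence the law of (X i, X j) is a product of two measures; the
    diagonal has null sections since a density gives no mass to points. *)
Lemma iid_ties i j : i != j -> P.-negligible [set w | X i w = X j w].
Proof.
move=> ij.
pose m k : probability R R := distribution P (X k).
have mXY : measurable_fun [set: T] (fun w => (X i w, X j w)).
  exact: measurable_fun_pair.
pose XY : {mfun T >-> (R * R)%type} := mfun_Sub (mem_set mXY).
pose m2 : {measure set (R * R) -> \bar R} := distribution P XY.
have mD : measurable [set z : R * R | z.1 = z.2].
  rewrite (_ : [set _ | _] = (fun z : R * R => z.1 - z.2) @^-1` [set 0]).
    rewrite -[X in measurable X]setTI.
    have mB : measurable_fun [set: R * R] (fun z : R * R => z.1 - z.2).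
      by apply: measurable_funB; [exact: measurable_fst|exact: measurable_snd].
    exact: mB.
  by apply/seteqP; split => z /= => [->|/eqP]; [rewrite subrr|rewrite subr_eq0 => /eqP].
have mT : measurable [set w | X i w = X j w].
  by have := mXY measurableT _ mD; rewrite setTI.
apply/negligibleP => //.
have E : ((m i \x m j) [set z | z.1 = z.2] = m2 [set z | z.1 = z.2])%E.
  apply: product_measure_unique => // A B mA mB.
  by rewrite /m2 /distribution/= /pushforward/= -iid_pair.
change (m2 [set z | z.1 = z.2] = 0%E); rewrite -E.
rewrite /product_measure1/=; apply: integral0_eq => x _ /=.
rewrite (_ : xsection _ _ = [set x]).
  by rewrite (iidX.2 j [set x])// integral_set1.
by apply/seteqP; split => y; rewrite /xsection/= inE/= => ->.
Qed.

Lemma sample_count n x w :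
  (count (fun y => y <= x) (sample X n w))%:R =
  \sum_(i < n) \1_(X i @^-1` `]-oo, x]) w :> R.
Proof.
rewrite /sample /mkseq count_map -sum1_count big_mkcond/= natr_sum.
rewrite -(big_mkord xpredT (fun i => \1_(X i @^-1` `]-oo, x]) w)).
rewrite /index_iota subn0.
apply: eq_bigr => i _; rewrite indicE /=.
have -> : (w \in X i @^-1` `]-oo, x]) = (X i w <= x).
  by apply/idP/idP; rewrite inE/= in_itv.
by case: ifP.
Qed.

Lemma sample_count_deviation n x (F t : R) : 0 < t ->
  P (X 0%N @^-1` `]-oo, x]) = F%:E ->
  (P [set w | (t <= `|(count (fun y => y <= x) (sample X n w))%:R - n%:R * F|)%R] <=
   (n%:R / (4 * t ^+ 2))%:E)%E.
Proof.
move=> t0 PF.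
have mA i : measurable (X i @^-1` `]-oo, x]).
  rewrite -[Y in measurable Y]setTI; exact: measurable_funPT.
have PA i : P (X i @^-1` `]-oo, x]) = F%:E.
  have := iidX.2 i `]-oo, x]%classic (measurable_itv _).
  by rewrite -(iidX.2 0%N)// -PF.
have iA i j : i != j ->
    (P (X i @^-1` `]-oo, x] `&` X j @^-1` `]-oo, x]) =
     P (X i @^-1` `]-oo, x]) * P (X j @^-1` `]-oo, x]))%E.
  by move=> ij; rewrite iid_pair.
have := chebyshev_count mA PA iA n t0.
by under eq_set do rewrite -sample_count.
Qed.

End iid_sample.

(** * Order statistics, nodes and cells *)

Section order_statistics.
Context {R : realType}.
Implicit Types (t xs : seq R) (x : R).

(** In a sorted sequence the entries that are at most x come first.  This turns
    statements about order statistics into statements about empirical counts, and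
    statements about cells into statements about nodes. *)
Lemma sorted_nth_le t x j : sorted <=%R t -> (j < size t)%N ->
  (nth 0 t j <= x) = (j < count (fun y => y <= x)%R t)%N.
Proof.
move=> st jt; apply/idP/idP => [tx|].
  rewrite -(cat_take_drop j.+1 t) count_cat.
  apply: leq_trans (leq_addr _ _).
  have /eqP -> : count (fun y => y <= x) (take j.+1 t) == size (take j.+1 t).
    rewrite -all_count; apply/(all_nthP 0) => k; rewrite size_takel// => kj.
    rewrite nth_take//; apply: le_trans tx.
    by apply: sorted_leq_nth => //; rewrite ?inE ?(leq_ltn_trans _ jt)//;
      exact: le_trans.
  by rewrite size_takel.
apply: contraTT; rewrite -ltNge -leqNgt => xt.
rewrite -(cat_take_drop j t) count_cat.
have /eqP -> : count (fun y => y <= x) (drop j t) == 0%N.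
  rewrite -leqn0 leqNgt -has_count; apply/hasPn => y /(nthP 0)[k].
  rewrite size_drop => kj <-; rewrite -ltNge nth_drop; apply: (lt_le_trans xt).
  by apply: sorted_leq_nth => //; rewrite ?inE -?ltn_subRL ?leq_addr//; exact: le_trans.
by rewrite addn0 (leq_trans (count_size _ _))// size_take; case: ifP => //; lia.
Qed.

Lemma order_stat_le xs x j : (0 < j <= size xs)%N ->
  (order_stat xs j <= x) = (j <= count (fun y => y <= x)%R xs)%N.
Proof.
move=> jn; rewrite /order_stat sorted_nth_le ?size_sort; last by lia.
  rewrite prednK; last by case/andP: jn.
  by congr (_ <= _)%N; exact/permP/permEl/perm_sort.
exact: (sort_le_sorted xs).
Qed.

Lemma order_stat_lt xs i j : uniq xs -> (0 < i)%N -> (i < j)%N ->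
  (j <= size xs)%N -> order_stat xs i < order_stat xs j.
Proof.
move=> uxs i0 ij jn; rewrite /order_stat.
apply: (sorted_ltn_nth lt_trans); rewrite ?inE ?size_sort ?sort_lt_sorted//;
  [apply: leq_trans jn|apply: leq_trans jn|]; lia.
Qed.

Lemma node_lt xs i : uniq xs -> (1 <= i < m_ R (size xs))%N ->
  node xs i < node xs i.+1.
Proof.
move=> uxs; rewrite /m_ /node ltnS; set s := (2 ^ _)%N => /andP[i1 im].
have s0 : (0 < s)%N by rewrite expn_gt0.
have ims : (i * s <= (size xs).-1)%N.
  by rewrite (leq_trans (leq_mul im (leqnn s)))// leq_divM.
have i1s : (i.-1 * s < i * s)%N by rewrite ltn_pmul2r//; lia.
by apply: order_stat_lt => //=; lia.
Qed.

Lemma node_le xs i j : uniq xs -> (1 <= i)%N -> (i <= j)%N ->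
  (j <= m_ R (size xs))%N -> node xs i <= node xs j.
Proof. by move=> uxs; apply: incr_seq_le => k; exact: node_lt. Qed.

Lemma cell_ge xs x j : uniq xs -> (1 <= j <= m_ R (size xs))%N ->
  (j <= cell xs x)%N = (node xs j <= x).
Proof.
move=> uxs /andP[j1 jm]; rewrite /cell.
set m := m_ _ _ in jm *.
have -> : count (fun i => node xs i <= x) (iota 1 m) =
          count (fun y => y <= x) (map (node xs) (iota 1 m)) by rewrite count_map.
have -> : node xs j = nth 0 (map (node xs) (iota 1 m)) j.-1.
  by rewrite (nth_map 0%N) ?size_iota ?nth_iota ?add1n ?prednK//; lia.
rewrite sorted_nth_le ?size_map ?size_iota ?prednK//.
apply: (@pairwise_sorted _ <=%R); rewrite pairwise_map.
apply/(pairwiseP 0%N) => a b; rewrite !inE !size_iota => am bm ab.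
rewrite !nth_iota//; apply: node_le; rewrite // /m in am bm *; lia.
Qed.
End order_statistics.

(** * Feasible vectors at the nodes *)

(** The index of the r-th end point of the blocks of level B: the pairs of
    index_pairs at this level are the (coarse_index B r, coarse_index B r.+1). *)
Definition coarse_index B r := (1 + r * 2 ^ B)%N.

Section band_near_affine.
Context {R : realType}.
Variables (alpha : R) (xs : seq R) (p q : R).
Hypothesis uxs : uniq xs.
Local Notation n := (size xs).
Local Notation m := (m_ R n).
Local Notation lam x := (p * x + q).
Local Notation y := (node xs).

(** The mass that the density exp (p x + q) gives to the cell i. *)
Definition affine_mass i : R := gap xs i * chord (lam (y i)) (lam (y i.+1)).

Let y_incr i : (1 <= i < m)%N -> y i < y i.+1.
Proof. exact: node_lt. Qed.

Lemma LamE (l : nat -> R) i : Lam xs l i = gap xs i * chord (l i) (l i.+1).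
Proof. by rewrite /Lam /chord mulrA. Qed.

Lemma fwdE (l g : nat -> R) i :
  fwd xs l g i = gap xs i * chord (l i) (l i + g i * gap xs i).
Proof. by rewrite /fwd /chord mulrCA mulrA addrAC subrr add0r. Qed.

Lemma bwdE (l g : nat -> R) i :
  bwd xs l g i = gap xs i * chord (l i.+1) (l i.+1 - g i.+1 * gap xs i).
Proof.
rewrite /bwd /chord mulrCA mulrA addrAC subrr add0r.
by rewrite /gap -mulrN opprB.
Qed.

(** The blocks r0, r0.+1 and rT, rT.+1 are the two pairs on which l is bounded
    from below somewhere, the block r0 + 2 separates the left pair from the block
    r0 + 3, on which l is bounded from above somewhere.  Concavity then bounds l
    below between the pairs, and above from the block r0 + 4 on. *)
Section coarse_level.
Variables (B r0 rT : nat) (th rho W : R).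
Hypothesis B_max : B%:Z <= Bmax R n.
Hypotheses (r0_ge1 : (1 <= r0)%N) (r0T : (r0 + 4 <= rT)%N).
Hypothesis rTn : (rT + 3 <= n_ R n B)%N.
Local Notation J := (coarse_index B).
Hypothesis mass_bounds : forall r, (r0 <= r < rT + 2)%N ->
  expR (- th) * (\sum_(J r <= i < J r.+1) affine_mass i) < c_ alpha n B /\
  d_ alpha n B < expR th * (\sum_(J r <= i < J r.+1) affine_mass i).
Hypotheses (th0 : 0 <= th) (rho0 : 0 < rho).
Hypothesis spacer : rho <= y (J (r0 + 3)) - y (J (r0 + 2)).
Hypothesis width : y (J rT) - y (J (r0 + 3)) <= W.

Let B0 : (0 < 2 ^ B)%N. Proof. by rewrite expn_gt0. Qed.

Let J_lt r r' : (r < r')%N -> (J r < J r')%N.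
Proof. by move=> rr'; rewrite /coarse_index ltn_add2l ltn_pmul2r. Qed.

Let J_le r r' : (r <= r')%N -> (J r <= J r')%N.
Proof. by move=> rr'; rewrite /coarse_index leq_add2l leq_mul2r rr' orbT. Qed.

Lemma coarse_index_le r : (r <= rT + 2)%N -> (J r <= m.-1)%N.
Proof.
move=> rrT; have rJ : (J r < J (rT + 3))%N by apply: J_lt; rewrite addnS ltnS.
rewrite /m_ /= -ltnS; apply: (leq_trans rJ).
rewrite /coarse_index add1n ltnS.
rewrite (@leq_trans (n_ R n B * 2 ^ B)%N)// ?leq_mul2r ?rTn ?orbT//.
by rewrite /n_ mulnC addnC expnD divnMA mulnC leq_divM.
Qed.

Let J_2 r : (r0 <= r)%N -> (2 <= J r)%N.
Proof. by move=> r0r; apply: (@J_lt 0); exact: leq_trans r0r. Qed.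

Let J_pair r : (r < rT + 3)%N -> index_pairs xs B (J r, J r.+1).
Proof. by move=> rrT; exists r.+1; split => //=; exact: leq_trans rTn. Qed.

Variables l g : nat -> R.
Hypothesis lg : feasible alpha xs (l, g).

Let tangent_nbr i j : (2 <= i <= m.-1)%N -> j = i.-1 \/ j = i.+1 ->
  l j <= l i + g i * (y j - y i).
Proof. by case: lg => + _ _ _; apply. Qed.

Let block_small r : (r0 <= r < rT + 2)%N ->
  exists2 z, (J r <= z <= J r.+1)%N & l z <= lam (y z) + th.
Proof.
move=> rr; have [_ dm] := mass_bounds rr.
apply: (node_small y_incr _ _ _ _ dm).
- by [].
- by apply: J_lt.
- by rewrite (leq_trans (coarse_index_le _)) ?leq_pred//; clear -rr; lia.
case: lg => _ _ _ /(_ B (J r) (J r.+1) B_max) /=.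
under eq_bigr do rewrite LamE.
by apply; apply: J_pair; clear -rr; lia.
Qed.

Let block_large r : (r0 <= r < rT + 1)%N ->
  exists2 w, (J r <= w <= J r.+2)%N & lam (y w) - th <= l w.
Proof.
move=> rr.
have [|cb _] := @mass_bounds r; first by clear -rr; lia.
have [|cf _] := @mass_bounds r.+1; first by clear -rr; lia.
apply: (@node_large _ y l g m y_incr tangent_nbr p q _ _ _ th _ _ _ _ _ _ cb _ cf).
- by apply: J_2; clear -rr; lia.
- exact: J_lt.
- exact: J_lt.
- by apply: coarse_index_le; clear -rr; lia.
- case: lg => _ /(_ B (J r) (J r.+1) B_max) + _ _ => /= /(_ _)/le_trans; apply.
    by apply: J_pair; clear -rr; lia.
  rewrite big_nat_cond [leRHS]big_nat_cond le_eqVlt; apply/orP; left; apply/eqP.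
  apply: eq_bigr => i; rewrite andbT => /andP[_ ir].
  (* The exceptional index m - 1 of U_ lies beyond the last block. *)
  rewrite /U_ ifN ?bwdE//; apply/eqP => im.
  by have := @coarse_index_le r.+1; rewrite -im; clear -rr ir; lia.
case: lg => _ _ /(_ B (J r.+1) (J r.+2) B_max) + _ => /= /(_ _)/le_trans; apply.
  by apply: J_pair; clear -rr; lia.
rewrite big_nat_cond [leRHS]big_nat_cond le_eqVlt; apply/orP; left; apply/eqP.
apply: eq_bigr => i; rewrite andbT => /andP[ir _].
(* The exceptional index 1 of V_ lies before the first block. *)
rewrite /V_ ifN ?fwdE//; apply/eqP => i1.
by have := @J_2 r.+1; clear -rr ir i1; lia.
Qed.

Lemma feasible_lower i : (J (r0 + 2) <= i <= J rT)%N -> lam (y i) - th <= l i.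
Proof.
move=> /andP[i1 i2].
have [|w /andP[w1 w2] lw] := @block_large r0; first by clear -r0T; lia.
have [|w' /andP[w'1 w'2] lw'] := @block_large rT; first by clear -r0T; lia.
have Jr0 := J_2 (leqnn r0).
have JrT : (J (rT + 2) <= m.-1)%N by exact: coarse_index_le.
rewrite !addn2 in i1 JrT.
have A : (2 <= J r0.+2)%N by exact: J_2 (leqW (leqnSn _)).
have C : (J rT <= J rT.+2)%N by apply: J_le; clear; lia.
apply: (ge_between y_incr tangent_nbr _ _ _ _ lw lw').
all: by clear -i1 i2 w1 w2 w'1 w'2 Jr0 JrT A C; lia.
Qed.

Lemma feasible_upper i : (J (r0 + 4) <= i <= J rT)%N ->
  l i <= lam (y i) + th * (1 + 2 * W / rho).
Proof.
move=> /andP[i1 i2].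
have [|w /andP[w1 w2] lw] := @block_large r0; first by clear -r0T; lia.
have [|z /andP[z1 z2] lz] := @block_small (r0 + 3); first by clear -r0T; lia.
have Jr0 := J_2 (leqnn r0).
have JrT : (J (rT + 2) <= m.-1)%N by exact: coarse_index_le.
have C : (J rT <= J (rT + 2))%N by apply: J_le; clear; lia.
have D : (J r0.+2 <= J (r0 + 3))%N by apply: J_le; rewrite addn3.
have E : (J (r0 + 3).+1 = J (r0 + 4))%N by rewrite -addnS.
have F : (J r0 <= J r0.+2)%N by exact: J_le (leqW (leqnSn _)).
have yw : y w <= y (J (r0 + 2)).
  by rewrite addn2; apply: node_le => //; clear -i1 i2 w1 w2 z1 z2 Jr0 JrT C D E F; lia.
have yz : y (J (r0 + 3)) <= y z.
  by apply: node_le => //; clear -i1 i2 w1 w2 z1 z2 Jr0 JrT C D E F; lia.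
have yi : y i <= y (J rT).
  by apply: node_le => //; clear -i1 i2 w1 w2 z1 z2 Jr0 JrT C D E F; lia.
apply: (le_extrapolate y_incr tangent_nbr _ _ _ th0 rho0 _ _ lw lz).
- by clear -i1 i2 w1 w2 z1 z2 Jr0 JrT C D E F; lia.
- by clear -i1 i2 w1 w2 z1 z2 Jr0 JrT C D E F; lia.
- by clear -i1 i2 w1 w2 z1 z2 Jr0 JrT C D E F; lia.
- exact: le_trans spacer (lerB yz yw).
- exact: le_trans (lerB yi yz) width.
Qed.

End coarse_level.
End band_near_affine.

(** * From the nodes to the band *)

Section affine_interpolation.
Context {R : realFieldType}.
Implicit Types u v x r p c : R.

Lemma interpolation_ge p c u v x r (r' : R) : u < v -> u <= x <= v ->
  p * u + c <= r -> p * v + c <= r' ->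
  p * x + c <= r + (x - u) * ((r' - r) / (v - u)).
Proof.
move=> uv /andP[ux xv] ru rv.
have vu : 0 < v - u by rewrite subr_gt0.
have -> : r + (x - u) * ((r' - r) / (v - u)) =
          (r * (v - x) + r' * (x - u)) / (v - u) by field; rewrite gt_eqF.
rewrite ler_pdivlMr//.
have A : 0 <= (r - (p * u + c)) * (v - x) by rewrite mulr_ge0 ?subr_ge0.
have B : 0 <= (r' - (p * v + c)) * (x - u) by rewrite mulr_ge0 ?subr_ge0.
lra.
Qed.

Lemma interpolation_le p c u v x r (r' : R) : u < v -> u <= x <= v ->
  r <= p * u + c -> r' <= p * v + c ->
  r + (x - u) * ((r' - r) / (v - u)) <= p * x + c.
Proof.
move=> uv uxv ru rv.
have := @interpolation_ge (- p) (- c) u v x (- r) (- r') uv uxv.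
have -> : - r + (x - u) * ((- r' - - r) / (v - u)) =
          - (r + (x - u) * ((r' - r) / (v - u))) by ring.
by rewrite !mulNr -!opprD !lerN2; apply.
Qed.

End affine_interpolation.

(** The extrapolations in muhat range over all the nodes, while estimates of l
    are available from jl (from below) and ju (from above) to jr only; elsewhere
    the tangent inequality takes over. *)
Section band_from_nodes.
Context {R : realType}.
Variables (alpha : R) (xs : seq R) (p q : R).
Hypothesis uxs : uniq xs.
Local Notation n := (size xs).
Local Notation m := (m_ R n).
Local Notation lam x := (p * x + q).
Local Notation y := (node xs).

Variables (jl ju jr : nat) (th th' rho W : R).
Hypotheses (jl2 : (2 <= jl)%N) (jlu : (jl < ju)%N).
Hypotheses (ju_jr : (ju < jr)%N) (jrm : (jr < m.-1)%N).
Hypotheses (th0 : 0 <= th) (th'0 : 0 <= th') (rho0 : 0 < rho).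
Hypothesis low : forall lg, feasible alpha xs lg ->
  forall i, (jl <= i <= jr)%N -> lam (y i) - th <= lg.1 i.
Hypothesis up : forall lg, feasible alpha xs lg ->
  forall i, (ju <= i <= jr)%N -> lg.1 i <= lam (y i) + th'.
Hypothesis spacer : rho <= y ju - y jl.
Hypothesis width : y jr - y ju <= W.
Hypothesis ex : band_exists alpha xs.

Lemma muhat_nodeP i : (ju <= i <= jr)%N -> exists r,
  [/\ muhat_node alpha xs i = r%:E, lam (y i) - th <= r & r <= lam (y i) + th'].
Proof.
move=> iu; have [lg lgF] := ex.
have A : ((lam (y i) - th)%:E <= muhat_node alpha xs i)%E.
  apply: (@le_trans _ _ (lg.1 i)%:E); last by apply: ereal_sup_ubound; exists lg.
  by rewrite lee_fin; apply: low => //; clear -jlu iu; lia.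
have B : (muhat_node alpha xs i <= (lam (y i) + th')%:E)%E.
  by apply: ge_ereal_sup => _ [lg' lgF' <-]; rewrite lee_fin; exact: up.
move: A B; case: (muhat_node alpha xs i) => [r||]//=.
by rewrite !lee_fin => A B; exists r.
Qed.

Lemma lhat_nodeP i : (jl <= i <= jr)%N -> exists r,
  [/\ lhat_node alpha xs i = r%:E, lam (y i) - th <= r &
      forall lg, feasible alpha xs lg -> r <= lg.1 i].
Proof.
move=> iu; have [lg lgF] := ex.
have A lg' : feasible alpha xs lg' -> (lhat_node alpha xs i <= (lg'.1 i)%:E)%E.
  by move=> lgF'; apply: ereal_inf_lbound; exists lg'.
have B : ((lam (y i) - th)%:E <= lhat_node alpha xs i)%E.
  by apply: le_ereal_inf_tmp => _ [lg' lgF' <-]; rewrite lee_fin; apply: low.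
move: A B; case: (lhat_node alpha xs i) => [r A B|/(_ _ lgF)//|_ //].
exists r; split => [//||lg' lgF']; first by rewrite -lee_fin.
by rewrite -lee_fin; exact: A.
Qed.

Section at_a_point.
Variables (x : R) (i : nat).
Hypotheses (cell_x : cell xs x = i) (ui : (ju <= i)%N) (ir : (i < jr)%N).
Hypotheses (yi : y i <= x) (yi1 : x < y i.+1).

Let i_2m : (2 <= i <= m.-1)%N. Proof. by clear -jl2 jlu ju_jr jrm ui ir; lia. Qed.
Let i1_2m : (2 <= i.+1 <= m.-1)%N. Proof. by clear -jl2 jlu ju_jr jrm ui ir; lia. Qed.
Let i_1m : (1 <= i <= m)%N. Proof. by clear -jl2 jlu ju_jr jrm ui ir; lia. Qed.
Let i1_1m : (1 <= i.+1 <= m)%N. Proof. by clear -jl2 jlu ju_jr jrm ui ir; lia. Qed.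
Let i_ur : (ju <= i <= jr)%N. Proof. by rewrite ui ltnW. Qed.
Let i1_ur : (ju <= i.+1 <= jr)%N. Proof. by rewrite ir leqW. Qed.
Let i_lr : (jl <= i <= jr)%N. Proof. by rewrite (ltnW ir) (leq_trans (ltnW jlu)). Qed.
Let i1_lr : (jl <= i.+1 <= jr)%N. 
Proof. by rewrite ir leqW// (leq_trans (ltnW jlu)). Qed.

Lemma lhatP : exists r,
  [/\ lhat alpha xs x = r%:E, lam x - th <= r & r <= lam x + th'].
Proof.
have [lg lgF] := ex.
have [r [rE r1 r2]] := lhat_nodeP i_lr.
have [r' [r'E r'1 r'2]] := lhat_nodeP i1_lr.
have yy : y i < y i.+1 by exact: le_lt_trans yi yi1.
have xy : y i <= x <= y i.+1 by rewrite yi ltW.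
exists (r + (x - y i) * ((r' - r) / (y i.+1 - y i))); split.
- rewrite /lhat cell_x ifT; last by clear -i_1m i1_2m; lia.
  by rewrite rE r'E -EFinB -!EFinM -EFinD.
- by rewrite -addrA; apply: interpolation_ge; rewrite // addrA.
rewrite -addrA; apply: interpolation_le; rewrite // addrA.
  by apply: le_trans (r2 _ lgF) _; exact: up.
by apply: le_trans (r'2 _ lgF) _; exact: up.
Qed.

Let y_incr k : (1 <= k < m)%N -> y k < y k.+1.
Proof. exact: node_lt. Qed.

Let tangent_lg lg k j : feasible alpha xs lg -> (2 <= k <= m.-1)%N ->
  (1 <= j <= m)%N -> lg.1 j <= lg.1 k + lg.2 k * (y j - y k).
Proof. by case=> C1lg _ _ _; apply: tangent. Qed.

(* L_ is a minimum over all the nodes on the left, but by the tangent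
   inequality none of the secants is below the slope of a feasible vector. *)
Let L_lower lg : feasible alpha xs lg -> ((lg.2 i)%:E <= L_ alpha xs i)%E.
Proof.
move=> lgF; rewrite /L_ big_nat_cond.
apply: (big_ind (fun z => (lg.2 i)%:E <= z)%E) => [|u v gu gv|j].
- exact: leey.
- by rewrite le_min gu.
rewrite andbT => /andP[j1 ji].
have yj : y j < y i.
  apply: (@lt_le_trans _ _ (y j.+1)); first by apply: y_incr;
    clear -jl2 jlu ju_jr jrm ui ir j1 ji; lia.
  by apply: node_le => //; clear -jl2 jlu ju_jr jrm ui ir j1 ji; lia.
apply: (@le_trans _ _ (((lg.1 i)%:E - (lg.1 j)%:E) * ((y i - y j)^-1)%:E)%E).
  rewrite -EFinB -EFinM lee_fin ler_pdivlMr ?subr_gt0//.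
  have j_1m : (1 <= j <= m)%N by clear -jl2 jlu ju_jr jrm ui ir j1 ji; lia.
  have := tangent_lg lgF i_2m j_1m; lra.
apply: lee_wpmul2r; first by rewrite lee_fin invr_ge0 subr_ge0 ltW.
apply: leeB; first by apply: ereal_sup_ubound; exists lg.
by apply: ereal_inf_lbound; exists lg.
Qed.

Let R_upper lg : feasible alpha xs lg -> (R_ alpha xs i.+1 <= (lg.2 i.+1)%:E)%E.
Proof.
move=> lgF; rewrite /R_ big_nat_cond.
apply: (big_ind (fun z => z <= (lg.2 i.+1)%:E)%E) => [|u v gu gv|j].
- exact: leNye.
- by rewrite ge_max gu.
rewrite andbT => /andP[j1 ji].
have yj : y i.+1 < y j.
  apply: (@lt_le_trans _ _ (y i.+2)); first by apply: y_incr;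
    clear -jl2 jlu ju_jr jrm ui ir j1 ji; lia.
  by apply: node_le => //; clear -jl2 jlu ju_jr jrm ui ir j1 ji; lia.
apply: (@le_trans _ _ (((lg.1 j)%:E - (lg.1 i.+1)%:E) * ((y j - y i.+1)^-1)%:E)%E).
  apply: lee_wpmul2r; first by rewrite lee_fin invr_ge0 subr_ge0 ltW.
  apply: leeB; first by apply: ereal_inf_lbound; exists lg.
  by apply: ereal_sup_ubound; exists lg.
rewrite -EFinB -EFinM lee_fin ler_pdivrMr ?subr_gt0//.
have j_1m : (1 <= j <= m)%N by clear -jl2 jlu ju_jr jrm ui ir j1 ji; lia.
have := tangent_lg lgF i1_2m j_1m; lra.
Qed.

Let muhatE : muhat alpha xs x =
  mine (muhat_node alpha xs i + L_ alpha xs i * (x - y i)%:E)%E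
       (muhat_node alpha xs i.+1 + R_ alpha xs i.+1 * (x - y i.+1)%:E)%E.
Proof.
have y1x : y 1 < x.
  apply: lt_le_trans yi; apply: (@lt_le_trans _ _ (y 2)).
    by apply: y_incr; clear -jl2 jlu ju_jr jrm ui ir; lia.
  by apply: node_le => //; clear -jl2 jlu ju_jr jrm ui ir; lia.
by rewrite /muhat gt_eqF// cell_x ifF ?ifT//; clear -jl2 jlu ju_jr jrm ui ir; lia.
Qed.

(** Both branches of muhat lie above the tangents of any feasible vector, hence
    above its interpolation. *)
Lemma muhat_lower : ((lam x - th)%:E <= muhat alpha xs x)%E.
Proof.
have [lg lgF] := ex.
have li := low lgF i_lr; have li1 := low lgF i1_lr.
have mi k : ((lg.1 k)%:E <= muhat_node alpha xs k)%E.
  by apply: ereal_sup_ubound; exists lg.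
have xy : y i <= x <= y i.+1 by rewrite yi ltW.
have yy : y i < y i.+1 by exact: le_lt_trans yi yi1.
have I : lam x - th <=
    lg.1 i + (x - y i) * ((lg.1 i.+1 - lg.1 i) / (y i.+1 - y i)).
  rewrite -addrA; apply: interpolation_ge => //; rewrite addrA.
    exact: li.
  exact: li1.
set s := _ / _ in I.
have sE : s * (y i.+1 - y i) = lg.1 i.+1 - lg.1 i.
  by rewrite /s divfK// gt_eqF// subr_gt0.
have si : s <= lg.2 i.
  rewrite -(@ler_pM2r _ (y i.+1 - y i)) ?subr_gt0// sE.
  have := tangent_lg lgF i_2m i1_1m; lra.
have si1 : lg.2 i.+1 <= s.
  rewrite -(@ler_pM2r _ (y i.+1 - y i)) ?subr_gt0// sE.
  have := tangent_lg lgF i1_2m i_1m; lra.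
rewrite muhatE le_min; apply/andP; split.
  apply: (@le_trans _ _ ((lg.1 i)%:E + (lg.2 i)%:E * (x - y i)%:E)%E).
    rewrite -EFinM -EFinD lee_fin; apply: (le_trans I).
    by rewrite lerD2l mulrC ler_wpM2r// subr_ge0.
  apply: leeD => //; apply: lee_wpmul2r; first by rewrite lee_fin subr_ge0.
  exact: L_lower.
apply: (@le_trans _ _ ((lg.1 i.+1)%:E + (lg.2 i.+1)%:E * (x - y i.+1)%:E)%E).
  rewrite -EFinM -EFinD lee_fin; apply: (le_trans I).
  have : 0 <= (s - lg.2 i.+1) * (y i.+1 - x).
    by rewrite mulr_ge0// subr_ge0// ltW.
  have <- : lg.1 i + s * (y i.+1 - y i) = lg.1 i.+1 by rewrite sE; ring.
  by lra.
apply: leeD => //; rewrite -opprB EFinN !muleN leeN2.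
apply: lee_wpmul2r; first by rewrite lee_fin subr_ge0 ltW.
exact: R_upper.
Qed.

(** An upper bound on the minimum L_ needs one secant only: the one to the
    node jl, at a distance of at least rho, over which the errors th and th'
    contribute at most (th' + th) / rho to the slope. *)
Lemma muhat_upper :
  (muhat alpha xs x <= (lam x + th' + (th' + th) / rho * W)%:E)%E.
Proof.
have [r [rE r1 r2]] := muhat_nodeP i_ur.
have [|r' [r'E r'1 _]] := @lhat_nodeP jl; first by clear -jl2 jlu ju_jr jrm ui ir; lia.
have yju : y ju <= y i by apply: node_le => //; clear -jl2 jlu ju_jr jrm ui ir; lia.
have yij : rho <= y i - y jl by exact: le_trans spacer (lerB yju (lexx _)).
have ij0 : 0 < y i - y jl by exact: lt_le_trans yij.
have xjr : x <= y jr.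
  by apply: le_trans (ltW yi1) _; apply: node_le => //; clear -jl2 jlu ju_jr jrm ui ir; lia.
have xW : x - y i <= W by exact: le_trans (lerB xjr yju) width.
rewrite muhatE; apply: (@le_trans _ _
  (muhat_node alpha xs i + L_ alpha xs i * (x - y i)%:E)%E).
  by rewrite ge_min lexx.
have Ljl : (L_ alpha xs i <= ((r - r') / (y i - y jl))%:E)%E.
  rewrite EFinM EFinB -rE -r'E.
  by apply: ge_bigmin_seq => //; rewrite mem_index_iota; clear -jl2 jlu ju_jr jrm ui ir; lia.
apply: (@le_trans _ _ (r%:E + ((r - r') / (y i - y jl))%:E * (x - y i)%:E)%E).
  rewrite rE; apply: leeD => //; apply: lee_wpmul2r => //.
  by rewrite lee_fin subr_ge0.
rewrite -EFinM -EFinD lee_fin.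
have A : (r - r') / (y i - y jl) <= p + (th' + th) / rho.
  rewrite ler_pdivrMr//.
  have : (th' + th) <= (th' + th) / rho * (y i - y jl).
    by rewrite mulrAC ler_pdivlMr// ler_wpM2l// addr_ge0.
  lra.
have B : 0 <= (th' + th) / rho by rewrite divr_ge0 ?addr_ge0// ltW.
have x0 : 0 <= x - y i by rewrite subr_ge0.
have C : (r - r') / (y i - y jl) * (x - y i) <=
         p * (x - y i) + (th' + th) / rho * W.
  apply: le_trans (ler_wpM2r x0 A) _; rewrite mulrDl lerD2l.
  exact: ler_wpM2l.
lra.
Qed.

Lemma muhatP : exists r,
  [/\ muhat alpha xs x = r%:E, lam x - th <= r &
      r <= lam x + th' + (th' + th) / rho * W].
Proof.
move: muhat_lower muhat_upper; case: (muhat alpha xs x) => [r||]//=.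
by rewrite !lee_fin => A B; exists r.
Qed.

End at_a_point.

Lemma band_near_affine x : y ju <= x -> x < y jr -> exists r r' : R,
  [/\ muhat alpha xs x = r%:E, lhat alpha xs x = r'%:E,
      lam x - th <= r <= lam x + th' + (th' + th) / rho * W &
      lam x - th <= r' <= lam x + th'].
Proof.
move=> xl xr.
have ui : (ju <= cell xs x)%N by rewrite cell_ge// ?xl; clear -jl2 jlu ju_jr jrm; lia.
have ir : (cell xs x < jr)%N.
  by rewrite ltnNge cell_ge -?ltNge//; clear -jl2 jlu ju_jr jrm; lia.
have yi : y (cell xs x) <= x.
  by rewrite -cell_ge//; clear -jl2 jlu ju_jr jrm ui ir; lia.
have yi1 : x < y (cell xs x).+1.
  by rewrite ltNge -cell_ge// ?ltnn//; clear -jl2 jlu ju_jr jrm ui ir; lia.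
have [r [-> r1 r2]] := muhatP erefl ui ir yi yi1.
have [r' [-> r'1 r'2]] := lhatP erefl ui ir yi yi1.
by exists r, r'; split => //; apply/andP.
Qed.

End band_from_nodes.

(** * The distribution function where the log density is affine *)

Section log_affine_distribution_function.
Context {R : realType}.
Variables (f : R -> R) (a0 b0 p q : R).
Hypotheses (f_density : is_density f) (ab0 : a0 < b0).
Hypothesis f_aff : forall x, a0 <= x <= b0 -> f x = expR (p * x + q).
Local Notation mu := (@lebesgue_measure R).
Local Notation lam x := (p * x + q).

Definition density_cdf x : R := \int[mu]_(t in `]-oo, x]) f t.
Local Notation G := density_cdf.

Let int_f : mu.-integrable setT (EFin \o f).
Proof.
case: f_density => mf f0 f1; apply/integrableP; split; first exact/measurable_EFinP.
by under eq_integral do rewrite /= ger0_norm//; rewrite f1 ltry.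
Qed.

Lemma density_cdfE x : (\int[mu]_(t in `]-oo, x]) (f t)%:E = (G x)%:E)%E.
Proof.
rewrite /G /Rintegral fineK//; apply: integrable_fin_num => //.
exact: integrableS int_f.
Qed.

Lemma density_cdf_le1 x : G x <= 1.
Proof.
case: f_density => mf f0 f1.
rewrite -lee_fin -density_cdfE -f1; apply: ge0_subset_integral => //.
  exact/measurable_EFinP.
by move=> t _; rewrite lee_fin.
Qed.

Lemma density_cdf_ge0 x : 0 <= G x.
Proof. by case: f_density => mf f0 f1; apply: Rintegral_ge0. Qed.

Let GB x y : x <= y -> G y - G x = \int[mu]_(t in `[x, y]) f t.
Proof.
move=> xy; rewrite /G Rintegral_itvB//.
- by rewrite Rintegral_itv_obnd_cbnd//; apply: integrableS int_f.
- exact: integrableS int_f.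
Qed.

Lemma density_cdf_mono x y : x <= y -> G x <= G y.
Proof.
case: f_density => mf f0 f1 xy.
by rewrite -subr_ge0 GB//; apply: Rintegral_ge0.
Qed.

Lemma density_cdfB x y : a0 <= x -> x < y -> y <= b0 ->
  G y - G x = (y - x) * chord (lam x) (lam y).
Proof.
move=> ax xy yb; rewrite GB ?(ltW xy)//.
rewrite -[RHS]/(fine _%:E) -integral_expR_affine// /Rintegral.
congr fine; apply: eq_integral => t; rewrite inE/= in_itv/= => /andP[xt ty].
by rewrite f_aff// (le_trans ax xt) (le_trans ty yb).
Qed.

(** The maximum of p x + q on [a0, b0]. *)
Definition log_max : R := Num.max (lam a0) (lam b0).

Lemma lam_le_max x : a0 <= x <= b0 -> lam x <= log_max.
Proof.
move=> /andP[ax xb]; rewrite /log_max le_max.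
have [p0|/ltW p0] := leP 0 p.
  by rewrite orbC lerD2r ler_wpM2l.
by rewrite lerD2r ler_wnM2l.
Qed.

Let chordMM (v : R) : chord v v = expR v.
Proof.
rewrite chordE subrr.
under eq_Rintegral do rewrite mul0r addr0.
rewrite Rintegral_cst//= lebesgue_measure_itv/= lte_fin ltr01.
by rewrite oppr0 adde0 mulr1.
Qed.

Lemma density_cdf_lipschitz x y : a0 <= x -> x <= y -> y <= b0 ->
  G y - G x <= expR log_max * (y - x).
Proof.
move=> ax; rewrite le_eqVlt => /predU1P[->|xy] yb; first by rewrite !subrr mulr0.
rewrite density_cdfB// mulrC ler_wpM2r ?subr_ge0 ?(ltW xy)//.
rewrite -chordMM; apply: chord_le; apply: lam_le_max.
  by rewrite ax (le_trans (ltW xy)).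
by rewrite yb (le_trans ax (ltW xy)).
Qed.

Lemma density_cdf_lt x y : a0 <= x -> x < y -> y <= b0 -> G x < G y.
Proof.
move=> ax xy yb; rewrite -subr_gt0 density_cdfB// mulr_gt0 ?subr_gt0//.
apply: (@lt_le_trans _ _ (chord (Num.min (lam x) (lam y)) (Num.min (lam x) (lam y)))).
  by rewrite chordMM expR_gt0.
by apply: chord_le; rewrite ge_min lexx ?orbT.
Qed.

Lemma density_quantile v : G a0 <= v <= G b0 -> exists2 x, a0 <= x <= b0 & G x = v.
Proof.
move=> vab.
pose h x := G a0 + parameterized_integral mu a0 x f.
have hE x : a0 <= x -> h x = G x.
  by move=> ax; rewrite /h /parameterized_integral -GB// addrC subrK.
have [|||x] := @IVT R h a0 b0 v.
- exact: ltW.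
- move=> x; apply: cvgD; first exact: cvg_cst.
  apply: parameterized_integral_continuous; first exact: ltW.
  exact: integrableS int_f.
- by case/andP: vab => va vb; rewrite !hE ?(ltW ab0)// ge_min le_max va vb orbT.
rewrite in_itv/= => xab <-; exists x => //; rewrite hE//.
by case/andP: xab.
Qed.

End log_affine_distribution_function.

(** * The critical values at a coarse level *)

Section tuning_bounds.
Context {R : realType}.

Definition eta n : R := Num.sqrt (ln (ln n%:R) / n%:R).

(** Blocks of 2 ^ coarse_log observations contain a proportion of the sample
    between 2 ^- K.+1 and 2 ^- K: the scale is fixed by K and independent of n.
    The level n enters the critical values only through the weights of the
    multiscale procedure. *)
Variables (alpha : R) (K n : nat).
Hypotheses (alpha01 : 0 < alpha < 1) (K4 : (4 <= K)%N).
Hypothesis lnln_ge1 : 1 <= ln (ln n%:R : R).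
Hypothesis ln_small : ln n%:R <= n%:R / 2 ^+ K.+1 :> R.
Hypothesis ln_large : 2 ^+ (K + 6) / alpha < ln n%:R :> R.
Hypothesis eta_small : eta n <= (10 * 2 ^+ K.+1)^-1.

Definition coarse_log : nat := (trunc_log 2 n - K)%N.
Definition coarse_size : nat := (2 ^ coarse_log)%N.
Definition coarse_level : nat := (coarse_log - s_ R n)%N.
Local Notation e := coarse_log.
Local Notation N := coarse_size.
Local Notation B := coarse_level.
Local Notation nR := (n%:R : R).

Let ln_ge2 : 2 <= ln nR.
Proof.
have l0 : 0 < ln nR.
  by rewrite ltNge; apply/negP => /ln0 E; move: lnln_ge1; rewrite E; lra.
move: lnln_ge1 (expR_ge1Dx (1 : R)); rewrite -ler_expR lnK ?posrE//; lra.
Qed.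

Let n_gt0 : 0 < nR.
Proof. by rewrite ltNge; apply/negP => /ln0 E; move: ln_ge2; rewrite E; lra. Qed.

Let pK_gt0 k : 0 < 2 ^+ k :> R. Proof. by rewrite exprn_gt0. Qed.

Lemma sample_size_ge : (2 ^ K.+2 <= n)%N.
Proof.
rewrite -(ler_nat R) natrX exprS -ler_pdivlMr//.
exact: le_trans ln_ge2 ln_small.
Qed.

Let tl_geK : (K <= trunc_log 2 n)%N.
Proof.
by apply: trunc_log_max => //; apply: leq_trans sample_size_ge; rewrite leq_exp2l// !leqW.
Qed.

Lemma coarse_size_le : (N * 2 ^ K <= n)%N.
Proof.
rewrite /N -expnD subnK//; apply: trunc_logP => //.
by apply: leq_trans sample_size_ge; rewrite expn_gt0.
Qed.

Lemma coarse_size_gt : (n < N * 2 ^ K.+1)%N.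
Proof.
rewrite /N -expnD addnS subnK//; apply: trunc_log_ltn => //.
Qed.

Lemma coarse_ratio : (2 ^+ K.+1)^-1 < N%:R / nR <= (2 ^+ K)^-1.
Proof.
apply/andP; split.
  by rewrite ltr_pdivlMr// mulrC ltr_pdivrMr// -natrX -natrM ltr_nat coarse_size_gt.
by rewrite ler_pdivrMr// mulrC ler_pdivlMr// -natrX -natrM ler_nat coarse_size_le.
Qed.

Let s_le : (s_ R n <= e)%N.
Proof.
have ll0 : 0 < ln nR by exact: lt_le_trans ln_ge2.
have c0 : 0 <= Num.ceil (log2 (ln nR)).
  rewrite ceil_ge0; apply: (@lt_le_trans _ _ 0).
    by rewrite ltrN10.
  by rewrite /log2 divr_ge0// ln_ge0// ?ler1n//; move: ln_ge2; lra.
rewrite -lez_nat /s_ gez0_abs// ceil_le_int /log2.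
rewrite ler_pdivrMr ?ln_gt0 ?ltr1n//.
rewrite -[e%:~R]/(e%:R) mulr_natl -lnXn// ler_ln ?posrE//.
apply: (le_trans ln_small).
rewrite ler_pdivrMr// -natrX -natrX -natrM ler_nat ltnW//.
exact: coarse_size_gt.
Qed.

Lemma coarse_levelD : (B + s_ R n = e)%N.
Proof. by rewrite /B subnK. Qed.

Lemma coarse_level_max : B%:Z <= Bmax R n.
Proof.
rewrite /Bmax lerBrDr -PoszD coarse_levelD floor_ge_int /log2.
rewrite ler_pdivlMr ?ln_gt0 ?ltr1n//.
rewrite -[e%:~R]/(e%:R) [leLHS]mulr_natl -lnXn// ler_ln ?posrE ?divr_gt0//.
rewrite ler_pdivlMr// -natrX -natrM ler_nat.
apply: leq_trans coarse_size_le.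
by rewrite leq_mul2l (@leq_exp2l 2 3)// (ltnW K4) orbT.
Qed.

Lemma coarse_count : n_ R n B = (n.-1 %/ N)%N.
Proof. by rewrite /n_ coarse_levelD. Qed.

Lemma eta_gt0 : 0 < eta n.
Proof. by rewrite sqrtr_gt0 divr_gt0// (lt_le_trans _ lnln_ge1). Qed.

Lemma eta_sqr : eta n ^+ 2 = ln (ln nR) / nR.
Proof. by rewrite sqr_sqrtr// divr_ge0// ?ler0n// (le_trans _ lnln_ge1). Qed.

Let n_ge1 : 1 <= nR.
Proof.
by rewrite (_ : 1 = 1%:R)// ler_nat (leq_trans _ sample_size_ge)// expn_gt0.
Qed.

Lemma eta_ge_inv : nR^-1 <= eta n.
Proof.
rewrite -(@ler_pXn2r _ 2)// ?nnegrE ?invr_ge0 ?ler0n ?(ltW eta_gt0)// eta_sqr.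
rewrite expr2 ler_wpM2r ?invr_ge0 ?ler0n//.
by rewrite (le_trans _ lnln_ge1)// invf_le1.
Qed.

Let n_gt0N : (0 < n)%N. Proof. by rewrite -(ltr_nat R). Qed.

Let Bmax_ge0 : 0 <= Bmax R n.
Proof. exact: le_trans coarse_level_max. Qed.

Lemma t_ge : 2^-1 <= t_ R n.
Proof.
rewrite /t_ big_ltn_cond// Bmax_ge0 add0n lerDl.
by apply: sumr_ge0 => i _; rewrite invr_ge0.
Qed.

Let D : R := (trunc_log 2 n + 2)%:R.

Let Bmax_le_trunc_log i : i%:Z <= Bmax R n -> (i < (trunc_log 2 n).+1)%N.
Proof.
rewrite /Bmax lerBrDr -PoszD floor_ge_int /log2 ler_pdivlMr ?ln_gt0 ?ltr1n//.
rewrite -[(i + _)%N%:~R]/((i + s_ R n)%:R) [leLHS]mulr_natl -lnXn//.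
rewrite ler_ln ?posrE ?divr_gt0//.
rewrite ler_pdivlMr// -natrX -natrM ler_nat => H.
rewrite ltnS; apply: trunc_log_max => //; apply: leq_trans H.
rewrite expnD -mulnA leq_pmulr// muln_gt0 expn_gt0//.
Qed.

Lemma t_le : t_ R n <= D.
Proof.
have tn : ((trunc_log 2 n).+1 <= n)%N.
  apply: (@leq_trans (2 ^ trunc_log 2 n)); first exact: ltn_expl.
  exact: trunc_logP.
apply: (@le_trans _ _ (\sum_(0 <= i < n | true && (i < (trunc_log 2 n).+1)%N) 1)).
  rewrite /t_ big_mkcond [leRHS]big_mkcond; apply: ler_sum => i _ /=.
  case: ifP => [/Bmax_le_trunc_log ->|_]; last by case: ifP.
  by rewrite invf_le1 ?ltr0n ?addn2// ler1n.
by rewrite -big_nat_widen// big_const_nat iter_addr_0 subn0 ler_nat addn2.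
Qed.

Let N_gt0 : (0 < N)%N. Proof. by rewrite expn_gt0. Qed.

Let N_lt : (N < n)%N.
Proof.
apply: leq_trans coarse_size_le; apply: ltn_Pmulr N_gt0.
by rewrite -{1}(expn0 2) ltn_exp2l// (leq_trans _ K4).
Qed.

Lemma coarse_count_ge1 : (1 <= n_ R n B)%N.
Proof. by rewrite coarse_count divn_gt0// -ltnS prednK. Qed.

Lemma coarse_count_lt : (n_ R n B < 2 ^ K.+1)%N.
Proof.
rewrite coarse_count ltn_divLR ?expn_gt0// mulnC.
by apply: leq_ltn_trans coarse_size_gt; exact: leq_pred.
Qed.

Let ln2_ge : 2^-1 <= ln 2 :> R.
Proof.
have := @le_ln1Dx R (- 2^-1); have -> : 1 + - 2^-1 = 2^-1 :> R by lra.
by rewrite lnV ?posrE// lerN2; apply; lra.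
Qed.

Let D_le : D <= 4 * ln nR.
Proof.
have : (trunc_log 2 n)%:R * ln 2 <= ln nR.
  rewrite mulr_natl -lnXn// ler_ln ?posrE// -natrX ler_nat.
  exact: trunc_logP.
have t0 : 0 <= (trunc_log 2 n)%:R :> R by [].
rewrite /D natrD; move: ln_ge2 ln2_ge; nra.
Qed.

Let denom : R := 2 * (B + 2)%:R * (n_ R n B)%:R * t_ R n.

Let denom_ge : 2 <= denom.
Proof.
have h1 : 2 <= (B + 2)%:R :> R by rewrite natrD lerDr.
have h2 : 1 <= (n_ R n B)%:R :> R by rewrite ler1n coarse_count_ge1.
have h3 := t_ge.
have h4 : 4 <= 2 * (B + 2)%:R :> R by lra.
have h5 : 4 <= 2 * (B + 2)%:R * (n_ R n B)%:R :> R by nra.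
by rewrite /denom; nra.
Qed.

(* Crude bounds suffice: B + 2 and t_n are both O(log n), so that the level of
   the test of a coarse block is at least a constant over (log n) ^ 2. *)
Let denom_le : denom <= 2 ^+ (K + 6) * ln nR ^+ 2.
Proof.
have -> : 2 ^+ (K + 6) * ln nR ^+ 2 = 2 * (4 * ln nR) * 2 ^+ K.+1 * (4 * ln nR).
  by rewrite exprD (exprS 2 K); ring.
have h1 : (B + 2)%:R <= 4 * ln nR.
  apply: le_trans D_le; rewrite ler_nat leq_add2r.
  by rewrite -ltnS; apply: Bmax_le_trunc_log; exact: coarse_level_max.
have h2 : (n_ R n B)%:R <= 2 ^+ K.+1 :> R.
  by rewrite -natrX ler_nat ltnW// coarse_count_lt.
have h3 := le_trans t_le D_le.
have h4 : 0 <= t_ R n by apply: le_trans t_ge; lra.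
have h5 : 0 <= 2 * (B + 2)%:R :> R by exact: mulr_ge0.
have h6 : 0 <= 2 * (B + 2)%:R * (n_ R n B)%:R :> R by exact: mulr_ge0.
rewrite /denom; apply: ler_pM => //; apply: ler_pM => //.
by rewrite ler_pM2l.
Qed.

Let level_ge : alpha / (2 ^+ (K + 6) * ln nR ^+ 2) <= level alpha n B.
Proof.
case/andP: alpha01 => a0 a1.
rewrite /level ler_pM2l// lef_pV2 ?posrE//.
  by rewrite mulr_gt0// exprn_gt0// (lt_le_trans _ ln_ge2).
exact: lt_le_trans denom_ge.
Qed.

Let level_le : level alpha n B <= 2^-1.
Proof.
case/andP: alpha01 => a0 a1; have d0 := lt_le_trans (ltr0n R 2) denom_ge.
rewrite /level ler_pdivrMr//; move: denom_ge; rewrite /denom; lra.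
Qed.

(* At distance 4 * eta from the mode the tail is at most exp (- 3 log log n),
   one power of log n less than the level. *)
Let tail_lt : expR (- (n.-1%:R * (2 * eta n) ^+ 2)) < level alpha n B.
Proof.
case/andP: alpha01 => a0 a1; have l0 := lt_le_trans (ltr0n R 2) ln_ge2.
apply: lt_le_trans level_ge.
have n4 : 4 <= nR.
  rewrite ler_nat; apply: leq_trans sample_size_ge.
  by rewrite (@leq_exp2l 2 2).
apply: (@le_lt_trans _ _ (expR (- (3%:R * ln (ln nR))))).
  rewrite ler_expR lerN2 exprMn eta_sqr mulrCA mulrA -[leLHS]mulr1.
  have -> : n.-1%:R = nR - 1 by rewrite -subn1 natrB.
  have -> : 2 ^+ 2 * (nR - 1) * (ln (ln nR) / nR) =
            ln (ln nR) * (4 * (nR - 1) / nR) by field; rewrite gt_eqF.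
  rewrite mulr1 mulrC ler_pM2l ?(lt_le_trans _ lnln_ge1)//.
  by rewrite ler_pdivlMr//; move: n4; lra.
rewrite expRN expRM_natl lnK ?posrE//.
have P0 : 0 < 2 ^+ (K + 6) * ln nR ^+ 2 by rewrite mulr_gt0// exprn_gt0.
rewrite ltr_pdivlMr//.
have -> : (ln nR ^+ 3)^-1 * (2 ^+ (K + 6) * ln nR ^+ 2) = 2 ^+ (K + 6) / ln nR.
  by field; rewrite gt_eqF.
by rewrite ltr_pdivrMr// mulrC -ltr_pdivrMr.
Qed.

Let beta_parameters : [/\ (2 ^ (B + s_ R n))%N = N.-1.+1,
  (n.+1 - N.-1.+1)%N = (n - N).+1 & (N.-1 + (n - N))%N = n.-1].
Proof.
rewrite coarse_levelD -/N prednK//; split => //; first by rewrite subSn// ltnW.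
by move: N_gt0 N_lt; clear; lia.
Qed.

Let eta_small' : 10 * eta n < N%:R / nR.
Proof.
have /andP[+ _] := coarse_ratio; apply: le_lt_trans.
have := eta_small; rewrite invfM mulrC ler_pdivlMr//; lra.
Qed.

Let N_pred : N.-1%:R = N%:R - 1 :> R.
Proof. by rewrite -subn1 natrB. Qed.

Let n_pred : n.-1%:R = nR - 1.
Proof. by rewrite -subn1 natrB. Qed.

Let n1_gt0 : 0 < nR - 1.
Proof. by rewrite subr_gt0 ltr1n (leq_ltn_trans N_gt0 N_lt). Qed.

(** 5 * eta is 4 * eta for the beta tail, plus one eta for the distance from the
    mode (N - 1) / (n - 1) to N / n, which is at most 1 / n. *)
Lemma c_ge : N%:R / nR - 5 * eta n <= c_ alpha n B.
Proof.
have [E1 E2 E3] := beta_parameters; have e0 := eta_gt0.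
rewrite /c_ E1 E2; apply: (@qBeta_ge _ _ _ _ _ (2 * eta n)).
- by move: eta_small' e0; lra.
- by rewrite mulr_gt0.
- rewrite E3 N_pred n_pred.
  have inv := eta_ge_inv.
  have h : (N%:R / nR - 5 * eta n + 2 * (2 * eta n)) * (nR - 1) <=
           (N%:R / nR - nR^-1) * (nR - 1).
    by rewrite ler_wpM2r ?(ltW n1_gt0)//; move: inv; lra.
  apply: le_trans h _.
  have -> : (N%:R / nR - nR^-1) * (nR - 1) = (N%:R - 1) * (1 - nR^-1).
    by field; rewrite gt_eqF.
  apply: ler_piMr; first by rewrite subr_ge0 ler1n.
  by rewrite gerBl invr_ge0.
- by rewrite E3 -(ltr_nat R) n_pred.
- by rewrite E3; exact: tail_lt.
- by move: level_le; lra.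
Qed.

Lemma d_le : d_ alpha n B <= N%:R / nR + 5 * eta n.
Proof.
have [E1 E2 E3] := beta_parameters; have e0 := eta_gt0.
rewrite /d_ E1 E2; apply: (@qBeta_le _ _ _ _ _ (2 * eta n)).
- have /andP[_ r2] := coarse_ratio.
  have : (2 ^+ K)^-1 <= 2^-1 :> R.
    rewrite lef_pV2 ?posrE// -natrX ler_nat.
    by apply: (@leq_trans K); [exact: leq_trans K4|exact/ltnW/ltn_expl].
  by move: eta_small' r2; lra.
- by rewrite mulr_gt0.
- rewrite E3 N_pred n_pred.
  have h : N%:R / nR * (nR - 1) <=
           (N%:R / nR + 5 * eta n - 2 * (2 * eta n)) * (nR - 1).
    by rewrite ler_wpM2r ?(ltW n1_gt0)//; move: e0; lra.
  apply: le_trans h.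
  have -> : N%:R / nR * (nR - 1) = N%:R - N%:R / nR by field; rewrite gt_eqF.
  by rewrite lerB// ler_pdivrMr// mul1r ler_nat ltnW.
- by rewrite E3 -(ltr_nat R) n_pred.
- by rewrite E3 subKr; exact: (ltW tail_lt).
- by move: level_le; lra.
Qed.

End tuning_bounds.

(** * The band on a good sample *)

Section good_sample.
Context {R : realType}.
Variables (alpha : R) (f : R -> R) (a0 a b b0 p q : R) (K : nat).
Hypotheses (alpha01 : 0 < alpha < 1) (f_density : is_density f).
Hypotheses (a0a : a0 < a) (ab : a <= b) (bb0 : b < b0).
Hypothesis f_aff : forall x, a0 <= x <= b0 -> f x = expR (p * x + q).
Local Notation lam x := (p * x + q).
Local Notation G := (density_cdf f).

Hypothesis K4 : (4 <= K)%N.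
Hypothesis left_mass : 10 / 2 ^+ K <= G a - G a0.
Hypothesis right_mass : 10 / 2 ^+ K <= G b0 - G b.

(** With nu = N / n the mass of a block is within 2 * eta of nu and the critical
    values within 5 * eta.  For th = theta_const * eta the gain th * (nu - 5 eta)
    is at least 20 * eta, as nu - 5 * eta >= 2 ^- K.+1 / 2, and exceeds the
    10 * eta between nu - 5 * eta and nu + 5 * eta. *)
Definition theta_const : R := 40 * 2 ^+ K.+1.
(** A block has mass at least 2 ^- K.+1 / 2, hence at least this length under a
    density bounded by exp log_max. *)
Definition spacer_const : R := (2 * 2 ^+ K.+1)^-1 / expR (log_max a0 b0 p q).
Definition node_const : R := theta_const * (1 + 2 * (b0 - a0) / spacer_const).
Definition band_const : R :=
  node_const + (node_const + theta_const) / spacer_const * (b0 - a0).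

Variable xs : seq R.
Local Notation n := (size xs).
Local Notation nR := (n%:R : R).
Local Notation eta := (eta n : R).
Hypothesis lnln_ge1 : 1 <= ln (ln nR).
Hypothesis ln_small : ln nR <= nR / 2 ^+ K.+1.
Hypothesis ln_large : 2 ^+ (K + 6) / alpha < ln nR.
Hypothesis eta_small : eta <= (10 * 2 ^+ K.+1)^-1.
Local Notation N := (coarse_size K n).
Local Notation B := (@coarse_level R K n).
Local Notation nu := (N%:R / nR).

Hypothesis uxs : uniq xs.
(** The end points of the blocks sit at the quantiles r * N / n of the density,
    up to eta, as long as these quantiles lie between a0 and b0. *)
Hypothesis good : forall r, (r < 2 ^ K.+1)%N ->
  G a0 <= r%:R * nu - eta -> r%:R * nu + eta <= G b0 ->
  [/\ a0 <= order_stat xs (1 + r * N) <= b0,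
      r%:R * nu - eta <= G (order_stat xs (1 + r * N)) &
      G (order_stat xs (1 + r * N)) <= r%:R * nu + eta].

Let ab0 : a0 < b0. Proof. exact: lt_trans a0a (le_lt_trans ab bb0). Qed.

Let eta0 : 0 < eta. Proof. exact: eta_gt0. Qed.

Let nu_lt : (2 ^+ K.+1)^-1 < nu.
Proof. by case/andP: (coarse_ratio lnln_ge1 ln_small). Qed.

Let nu_le : nu <= (2 ^+ K)^-1.
Proof. by case/andP: (coarse_ratio lnln_ge1 ln_small). Qed.

Let nu0 : 0 < nu.
Proof. by apply: lt_trans nu_lt; rewrite invr_gt0 exprn_gt0. Qed.

Let eta_nu : 10 * eta < nu.
Proof.
apply: le_lt_trans nu_lt.
have := eta_small; rewrite invfM mulrC ler_pdivlMr//; lra.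
Qed.

Let left_nu : 10 * nu <= G a - G a0.
Proof. by apply: le_trans left_mass; rewrite ler_pM2l. Qed.

Let right_nu : 10 * nu <= G b0 - G b.
Proof. by apply: le_trans right_mass; rewrite ler_pM2l. Qed.

Let Gab : G a <= G b. Proof. exact: density_cdf_mono. Qed.

Let truncn_nu u : 0 <= u ->
  u + nu < (Num.truncn (u / nu) + 2)%:R * nu <= u + 2 * nu.
Proof.
move=> u0; have := @truncn_itv _ (u / nu) (divr_ge0 u0 (ltW nu0)).
rewrite ltr_pdivrMr// ler_pdivlMr// -natr1 natrD mulrDl mul1r mulrDl.
by move=> /andP[h1 h2]; apply/andP; split; lra.
Qed.

(** r0 is the first block that starts safely right of a0, so that the blocks
    up to r0 + 4 end left of a; rT is chosen in the same way for b and b0. *)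
Section layout.
Variables r0 rT : nat.
Hypothesis r0_itv : G a0 + nu < r0%:R * nu <= G a0 + 2 * nu.
Hypothesis rT_itv : G b + nu < rT%:R * nu <= G b + 2 * nu.

Let r0T : (r0 + 4 <= rT)%N.
Proof.
rewrite -(ler_nat R) -(ler_pM2r nu0) natrD mulrDl.
by move: r0_itv rT_itv left_nu Gab nu0 => /andP[_ ?] /andP[? _]; lra.
Qed.

Let rT3 : (rT + 3 <= n_ R n B)%N.
Proof.
rewrite (coarse_count lnln_ge1 ln_small) leq_divRL ?expn_gt0//.
have n0 : (0 < n)%N by apply: leq_trans (sample_size_ge lnln_ge1 ln_small); rewrite expn_gt0.
rewrite -ltnS prednK// -(ltr_nat R) natrM.
have : (rT + 3)%:R * nu < 1.
  rewrite natrD mulrDl.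
  move: rT_itv right_nu nu0 (density_cdf_le1 f_density b0) => /andP[_ ?]; lra.
by rewrite mulrA ltr_pdivrMr ?ltr0n// mul1r.
Qed.

Let block_end r : (r0 <= r <= rT + 2)%N ->
  G a0 + nu < r%:R * nu <= G b + 4 * nu.
Proof.
move=> /andP[r0r rrT].
have h1 : r0%:R * nu <= r%:R * nu by rewrite ler_pM2r// ler_nat.
have h2 : r%:R * nu <= (rT + 2)%:R * nu by rewrite ler_pM2r// ler_nat.
rewrite natrD mulrDl in h2.
by move: r0_itv rT_itv => /andP[? _] /andP[_ ?]; apply/andP; split; lra.
Qed.

Let good_node r : (r0 <= r <= rT + 2)%N ->
  [/\ a0 <= node xs (coarse_index B r) <= b0,
      r%:R * nu - eta <= G (node xs (coarse_index B r)) &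
      G (node xs (coarse_index B r)) <= r%:R * nu + eta].
Proof.
move=> rr; have /andP[h1 h2] := block_end rr.
have -> : node xs (coarse_index B r) = order_stat xs (1 + r * N).
  rewrite /node /coarse_index add1n /= -mulnA -expnD.
  by rewrite (coarse_levelD lnln_ge1 ln_small).
have h3 : r%:R * nu + eta <= G b0.
  by move: eta_nu right_nu nu0 h2; lra.
apply: good => //; last by move: eta_nu eta0 h1; lra.
rewrite -(ltr_nat R) natrX.
have : r%:R * nu < 1.
  by move: (density_cdf_le1 f_density b0) right_nu nu0 h2; lra.
have : r%:R * (2 ^+ K.+1)^-1 <= r%:R * nu by rewrite ler_wpM2l// ltW.
move=> h4 h5; have := le_lt_trans h4 h5.
by rewrite ltr_pdivrMr ?exprn_gt0// mul1r.
Qed.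

Let th : R := theta_const * eta.
Let th0 : 0 <= th.
Proof. by rewrite /th /theta_const !mulr_ge0 ?exprn_ge0// ltW. Qed.

Let mass_telescope r : (r0 <= r < rT + 2)%N ->
  \sum_(coarse_index B r <= i < coarse_index B r.+1) affine_mass xs p q i =
  G (node xs (coarse_index B r.+1)) - G (node xs (coarse_index B r)).
Proof.
move=> /andP[r0r rrT].
have [|/andP[ar _] _ _] := @good_node r; first by rewrite r0r ltnW.
have [|/andP[_ br] _ _] := @good_node r.+1; first by rewrite leqW.
have rm : (coarse_index B r.+1 <= (m_ R n).-1)%N.
  exact: (coarse_index_le rT3).
have r1 : (1 <= coarse_index B r)%N by [].
have rr1 : (coarse_index B r <= coarse_index B r.+1)%N.
  by rewrite /coarse_index leq_add2l leq_mul2r leqnSn orbT.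
rewrite -(telescope_sumr (fun i => G (node xs i)))//.
rewrite big_nat_cond [RHS]big_nat_cond; apply: eq_bigr => i; rewrite andbT => /andP[ri ir].
have lt_m k : (k <= coarse_index B r.+1)%N -> (k <= m_ R n)%N.
  by move=> /leq_trans/(_ rm)/leq_trans; apply; exact: leq_pred.
rewrite (@density_cdfB _ f a0 b0 p q)//.
- by apply: le_trans ar _; apply: node_le => //; apply: lt_m; exact: ltnW.
- apply: node_lt => //; rewrite (leq_trans r1 ri)/=.
  by apply: leq_trans (lt_m _ ir) _.
- by apply: le_trans br; apply: node_le => //; exact: lt_m.
Qed.

Let mass_bounds r : (r0 <= r < rT + 2)%N ->
  expR (- th) * (\sum_(coarse_index B r <= i < coarse_index B r.+1)
     affine_mass xs p q i) < c_ alpha n B /\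
  d_ alpha n B < expR th * (\sum_(coarse_index B r <= i < coarse_index B r.+1)
     affine_mass xs p q i).
Proof.
move=> rr; rewrite mass_telescope//; have /andP[r0r rrT] := rr.
have [|_ l1 u1] := @good_node r; first by rewrite r0r ltnW.
have [|_ l2 u2] := @good_node r.+1; first by rewrite leqW.
rewrite -natr1 mulrDl mul1r in l2 u2.
set M := _ - _.
have M1 : nu - 2 * eta <= M by rewrite /M; lra.
have M2 : M <= nu + 2 * eta by rewrite /M; lra.
have := c_ge alpha01 K4 lnln_ge1 ln_small ln_large eta_small.
have := d_le alpha01 K4 lnln_ge1 ln_small ln_large eta_small.
move=> dle cge.
have e1 : 1 + th <= expR th by exact: expR_ge1Dx.
have key : nu + 5 * eta < expR th * (nu - 5 * eta).
  apply: (@lt_le_trans _ _ ((1 + th) * (nu - 5 * eta))); last first.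
    by rewrite ler_wpM2r//; move: eta_nu nu0; lra.
  have h : 20 * eta <= th * (nu - 5 * eta).
    rewrite /th /theta_const.
    have -> : 40 * 2 ^+ K.+1 * eta * (nu - 5 * eta) =
       20 * eta * ((2 * (nu - 5 * eta)) * 2 ^+ K.+1) by ring.
    rewrite ler_peMr ?mulr_ge0 ?(ltW eta0)//.
    rewrite -ler_pdivrMr ?exprn_gt0// div1r.
    by apply: le_trans (ltW nu_lt) _; move: eta_nu; lra.
  by move: eta0 h; lra.
split.
  rewrite expRN mulrC ltr_pdivrMr ?expR_gt0//.
  apply: (@le_lt_trans _ _ (nu + 5 * eta)); first by move: eta0 M2; lra.
  by apply: (lt_le_trans key); rewrite mulrC ler_pM2r ?expR_gt0.
apply: (le_lt_trans dle); apply: (lt_le_trans key).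
by rewrite ler_pM2l ?expR_gt0//; move: eta0 M1; lra.
Qed.

Let spacer0 : 0 < spacer_const.
Proof. by rewrite /spacer_const divr_gt0 ?expR_gt0 ?invr_gt0 ?mulr_gt0 ?exprn_gt0. Qed.

Lemma band_of_layout x : band_exists alpha xs -> a <= x <= b -> exists r r' : R,
  [/\ muhat alpha xs x = r%:E, lhat alpha xs x = r'%:E,
      `|r - lam x| <= band_const * eta & `|r' - lam x| <= band_const * eta].
Proof.
move=> ex /andP[ax xb].
pose y r := node xs (coarse_index B r).
have h2 : (r0 <= r0 + 2 <= rT + 2)%N by clear -r0T; lia.
have h3 : (r0 <= r0 + 3 <= rT + 2)%N by clear -r0T; lia.
have h4 : (r0 <= r0 + 4 <= rT + 2)%N by clear -r0T; lia.
have hT : (r0 <= rT <= rT + 2)%N by clear -r0T; lia.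
have r0_gt0 : (0 < r0)%N.
  rewrite -(ltr_nat R) -(pmulr_lgt0 _ nu0); move: r0_itv => /andP[+ _].
  by apply: le_lt_trans; rewrite addr_ge0 ?(ltW nu0)// density_cdf_ge0.
have [/andP[y2a y2b] l2 u2] := good_node h2.
have [/andP[y3a y3b] l3 u3] := good_node h3.
have [/andP[y4a y4b] l4 u4] := good_node h4.
have [/andP[yTa yTb] lT uT] := good_node hT.
rewrite -/(y _) in y2a y2b l2 u2 y3a y3b l3 u3 y4a y4b l4 u4 yTa yTb lT uT.
have index_m r : (r <= rT + 2)%N -> (coarse_index B r <= m_ R n)%N.
  by move=> rr; apply: leq_trans (leq_pred _); apply: (coarse_index_le rT3).
have index_mono r r' : (r <= r')%N -> (coarse_index B r <= coarse_index B r')%N.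
  by move=> rr'; rewrite /coarse_index leq_add2l leq_mul2r rr' orbT.
have index_lt r r' : (r < r')%N -> (coarse_index B r < coarse_index B r')%N.
  by move=> rr'; rewrite /coarse_index ltn_add2l ltn_pmul2r// expn_gt0.
have y_mono r r' : (r <= r')%N -> (r' <= rT + 2)%N -> y r <= y r'.
  by move=> rr' r'T; apply: node_le => //; [exact: index_mono|exact: index_m].
have y4x : y (r0 + 4)%N <= x.
  rewrite leNgt; apply/negP => /ltW/(le_trans ax)/(density_cdf_mono f_density).
  move: r0_itv => /andP[_ h]; rewrite natrD mulrDl in u4.
  by move: eta_nu left_nu nu0 u4; lra.
have xyT : x < y rT.
  rewrite ltNge; apply/negP => /le_trans/(_ xb)/(density_cdf_mono f_density).
  move: rT_itv => /andP[h _].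
  by move: eta_nu nu0 eta0 lT; lra.
have spacer : spacer_const <= y (r0 + 3)%N - y (r0 + 2)%N.
  rewrite ler_pdivrMr ?expR_gt0// [leRHS]mulrC.
  have y23 : y (r0 + 2)%N <= y (r0 + 3)%N.
    by case/andP: h3 => _ h; apply: y_mono h; rewrite leq_add2l.
  apply: le_trans _ (density_cdf_lipschitz f_density f_aff y2a y23 y3b).
  rewrite natrD mulrDl in u2; rewrite natrD mulrDl in l3.
  by rewrite invfM; move: u2 l3 nu_lt eta_nu; lra.
have width : y rT - y (r0 + 3)%N <= b0 - a0 by exact: lerB.
have th'0 : 0 <= node_const * eta.
  rewrite mulr_ge0 ?(ltW eta0)// /node_const mulr_ge0//.
    by rewrite /theta_const mulr_ge0// exprn_ge0.
  by rewrite addr_ge0// divr_ge0 ?(ltW spacer0)// mulr_ge0// subr_ge0 ltW.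
have low lg : feasible alpha xs lg -> forall i,
    (coarse_index B (r0 + 2) <= i <= coarse_index B rT)%N ->
    lam (node xs i) - th <= lg.1 i.
  case: lg => l g lgF i iB.
  exact: (feasible_lower uxs (coarse_level_max K4 lnln_ge1 ln_small)
            r0_gt0 r0T rT3 mass_bounds lgF iB).
have up lg : feasible alpha xs lg -> forall i,
    (coarse_index B (r0 + 4) <= i <= coarse_index B rT)%N ->
    lg.1 i <= lam (node xs i) + node_const * eta.
  case: lg => l g lgF i iB.
  rewrite /node_const mulrAC.
  exact: (feasible_upper uxs (coarse_level_max K4 lnln_ge1 ln_small)
            r0_gt0 r0T rT3 mass_bounds
            th0 spacer0 spacer width lgF iB).
have spacer' : spacer_const <= y (r0 + 4)%N - y (r0 + 2)%N.
  by apply: le_trans spacer _; rewrite lerB// y_mono// ?leq_add2l//; case/andP: h4.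
have width' : y rT - y (r0 + 4)%N <= b0 - a0 by exact: lerB.
have jl2 : (1 < coarse_index B (r0 + 2))%N.
  by apply: (@index_lt 0%N); rewrite addn2.
have jlu : (coarse_index B (r0 + 2) < coarse_index B (r0 + 4))%N.
  by apply: index_lt; rewrite ltn_add2l.
have jur : (coarse_index B (r0 + 4) < coarse_index B rT)%N.
  rewrite ltnNge; apply/negP => /(node_le uxs); rewrite -/(y _) -/(y _) => h.
  have := le_lt_trans y4x xyT; rewrite ltNge h//.
  by apply: index_m; case/andP: h4.
have jrm : (coarse_index B rT < (m_ R n).-1)%N.
  apply: leq_trans (coarse_index_le rT3 (leqnn _)).
  by apply: index_lt; rewrite addn2 ltnS leqnSn.
have [r [r' [-> -> /andP[r1 r2] /andP[r'1 r'2]]]] :=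
  band_near_affine uxs jl2 jlu jur jrm th0 th'0 spacer0 low up spacer' width'
   ex y4x xyT.
have th_node : th <= node_const * eta.
  rewrite /node_const mulrAC ler_peMr// lerDl divr_ge0 ?(ltW spacer0)//.
  by rewrite mulr_ge0// subr_ge0 ltW.
have node_band : node_const * eta <= band_const * eta.
  rewrite ler_wpM2r ?(ltW eta0)// /band_const lerDl.
  rewrite mulr_ge0 ?subr_ge0 ?(ltW ab0)// divr_ge0 ?(ltW spacer0)//.
  rewrite -(pmulr_lge0 _ eta0) mulrDl addr_ge0//.
have bandE : band_const * eta = node_const * eta +
    (node_const * eta + th) / spacer_const * (b0 - a0).
  by rewrite /band_const /th; ring.
exists r, r'; split => //; rewrite ler_distl; apply/andP; split.
- by apply: le_trans r1; rewrite lerB// (le_trans th_node).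
- by rewrite bandE addrA.
- by apply: le_trans r'1; rewrite lerB// (le_trans th_node).
- by apply: le_trans r'2 _; rewrite lerD2l.
Qed.

End layout.

Lemma good_sample_band x : band_exists alpha xs -> a <= x <= b -> exists r r' : R,
  [/\ muhat alpha xs x = r%:E, lhat alpha xs x = r'%:E,
      `|r - lam x| <= band_const * eta & `|r' - lam x| <= band_const * eta].
Proof.
apply: band_of_layout; exact: truncn_nu (density_cdf_ge0 _ _).
Qed.

End good_sample.

(** * Good samples have probability tending to 1 *)

Section eventually.
Context {R : realType}.

Lemma lnln_large (A : R) : \forall n \near \oo, A <= ln (ln n%:R).
Proof.
near=> n; have nA : expR (expR A) <= n%:R by near: n; exact: nbhs_infty_ger.
have n0 : 0 < n%:R :> R by exact: lt_le_trans (expR_gt0 _) nA.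
have lA : expR A <= ln n%:R by rewrite -(expRK (expR A)) ler_ln ?posrE ?expR_gt0.
by rewrite -(expRK A) ler_ln ?posrE ?expR_gt0// (lt_le_trans (expR_gt0 _) lA).
Unshelve. all: by end_near. Qed.

Let ln_le_sqrt (x : R) : 0 < x -> ln x <= 2 * Num.sqrt x.
Proof.
move=> x0; have s0 : 0 < Num.sqrt x by rewrite sqrtr_gt0.
rewrite -{1}(sqr_sqrtr (ltW x0)) lnXn// -[leLHS]mulr_natl.
by rewrite ler_wpM2l// ltW// ln_sublinear.
Qed.

Lemma ln_negligible (e : R) : 0 < e -> \forall n \near \oo, ln n%:R <= e * n%:R.
Proof.
move=> e0; near=> n.
have n1 : 1 <= n%:R :> R by near: n; exact: nbhs_infty_ger.
have nA : (2 / e) ^+ 2 <= n%:R by near: n; exact: nbhs_infty_ger.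
have n0 : 0 < n%:R :> R by exact: lt_le_trans n1.
apply: le_trans (ln_le_sqrt n0) _.
have h : 2 / e <= Num.sqrt n%:R.
  have e2 : 0 <= 2 / e by rewrite divr_ge0// ltW.
  by rewrite -(ger0_norm e2) -sqrtr_sqr ler_wsqrtr.
rewrite -{2}(sqr_sqrtr (ltW n0)) expr2 mulrA ler_wpM2r ?sqrtr_ge0//.
by rewrite mulrC -ler_pdivrMr.
Unshelve. all: by end_near. Qed.

Lemma eta_vanishes (e : R) : 0 < e -> \forall n \near \oo, eta n <= e.
Proof.
move=> e0; near=> n.
have l1 : 1 <= ln (ln n%:R : R) by near: n; exact: lnln_large.
have ln1 : 0 < ln (n%:R : R).
  by rewrite ltNge; apply/negP => /ln0 E; move: l1; rewrite E; lra.
have n0 : 0 < n%:R :> R.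
  by rewrite ltNge; apply/negP => /ln0 E; move: ln1; rewrite E; lra.
have h : ln n%:R <= e ^+ 2 * n%:R :> R.
  by near: n; apply: ln_negligible; rewrite exprn_gt0.
rewrite /eta -(ger0_norm (ltW e0)) -sqrtr_sqr ler_wsqrtr//.
rewrite ler_pdivrMr//; apply: le_trans h.
by rewrite ltW// ln_sublinear.
Unshelve. all: by end_near. Qed.

End eventually.

Section probability_tending_to_1.
Context d (T : measurableType d) (R : realType) (P : probability T R).

Lemma inner_prob_le1 (E : set T) : (inner_prob P E <= 1)%E.
Proof. by apply: ge_ereal_sup => _ [A [mA _] <-]; exact: probability_le1. Qed.

(** Chebyshev at scale eta = sqrt (log log n / n) leaves exceptional sets of
    probability O(1 / log log n). *)
Lemma with_prob_tending_to_1_lnln (c : R) (E : nat -> set T) :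
  (\forall n \near \oo, exists2 A : set T, measurable A /\ ~` A `<=` E n &
     (P A <= (c / ln (ln n%:R))%:E)%E) ->
  with_prob_tending_to_1 P E.
Proof.
move=> H; rewrite /with_prob_tending_to_1.
have H1 : \forall n \near \oo,
    ((1 - c / ln (ln n%:R))%:E <= inner_prob P (E n) <= 1)%E.
  near=> n; rewrite inner_prob_le1 andbT.
  have [A [mA AE] PA] : exists2 A : set T, measurable A /\ ~` A `<=` E n &
     (P A <= (c / ln (ln n%:R))%:E)%E by near: n.
  apply: (@le_trans _ _ (P (~` A))).
    by rewrite probability_setC// EFinB leeB.
  by apply: ereal_sup_ubound; exists (~` A) => //; split => //; exact: measurableC.
apply: (squeeze_cvge H1); last exact: cvg_cst.
apply/fine_cvgP; split; first by apply: nearW => n.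
apply/cvgrPdist_le => e e0; near=> n.
have l1 : 1 <= ln (ln n%:R : R) by near: n; exact: lnln_large.
have l2 : `|c| / e <= ln (ln n%:R : R) by near: n; exact: lnln_large.
have l0 : 0 < ln (ln n%:R : R) by exact: lt_le_trans l1.
rewrite /= opprB addrC subrK normrM normfV (gtr0_norm l0).
by rewrite ler_pdivrMr// mulrC -ler_pdivrMr.
Unshelve. all: by end_near. Qed.

Lemma measure_bigcup_le (D : nat -> set T) (Q : nat) (c : R) :
  (forall r, measurable (D r)) -> (forall r, (P (D r) <= c%:E)%E) ->
  (P (\big[setU/set0]_(r < Q) D r) <= (Q%:R * c)%:E)%E.
Proof.
move=> mD PD; elim: Q => [|Q IH]; first by rewrite big_ord0 measure0 mul0r.
rewrite big_ord_recr/= -natr1 mulrDl mul1r EFinD.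
have mU : measurable (\big[setU/set0]_(r < Q) D r) by exact: bigsetU_measurable.
exact: le_trans (measureU2 P mU (mD Q)) (leeD IH (PD Q)).
Qed.

End probability_tending_to_1.

Section sample_is_good.
Context d (T : measurableType d) (R : realType) (P : probability T R).
Variables (f : R -> R) (X : nat -> {RV P >-> R}).
Hypotheses (f_density : is_density f) (iidX : iid_with_density f X).

Lemma sample_uniq_ae : P.-negligible [set w | ~ forall n, uniq (sample X n w)].
Proof.
apply: (@negligibleS _ _ _ _ (\bigcup_i \bigcup_j
    [set w | i != j /\ X i w = X j w])).
  move=> w /= /existsNP[n /negP/mkseq_uniqP].
  move=> H; apply: contrapT => H'; apply: H => i j _ _ Xij.
  apply/eqP; apply: contrapT => /negP ij; apply: H'.
  by exists i => //; exists j.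
apply: negligible_bigcup => i; apply: negligible_bigcup => j.
have [ij|ij] := eqVneq i j.
  rewrite (_ : [set _ | _] = set0); [exact: negligible_set0|].
  by apply/seteqP; split => w //= [].
by apply: negligibleS (iid_ties iidX ij) => w [].
Qed.

(** The event that the empirical distribution function at x is off by eta. *)
Definition count_deviates n x : set T :=
  [set w | n%:R * eta n <=
    `|(count (fun y => y <= x) (sample X n w))%:R - n%:R * density_cdf f x| :> R].

Lemma measurable_count_deviates n x : measurable (count_deviates n x).
Proof.
rewrite /count_deviates; under eq_set do rewrite (sample_count _ n x).
have mS : measurable_fun [set: T]
    (fun w => `|\sum_(i < n) \1_(X i @^-1` `]-oo, x]) w - n%:R * density_cdf f x| : R).
  apply: measurableT_comp => //; apply: measurable_funB => //.
  apply: measurable_sum => i; apply: measurable_indic.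
  by rewrite -[Y in measurable Y]setTI; exact: measurable_funPT.
have := mS measurableT `[n%:R * eta n, +oo[%classic (measurable_itv _).
by rewrite setTI; congr (measurable _); apply/seteqP; split => w /=; rewrite in_itv/= andbT.
Qed.

Lemma count_deviates_small n x : 1 <= ln (ln (n%:R : R)) ->
  (P (count_deviates n x) <= (4^-1 / ln (ln n%:R))%:E)%E.
Proof.
move=> l1.
have ln1 : 0 < ln (n%:R : R).
  by rewrite ltNge; apply/negP => /ln0 E; move: l1; rewrite E; lra.
have n0 : 0 < n%:R :> R.
  by rewrite ltNge; apply/negP => /ln0 E; move: ln1; rewrite E; lra.
have t0 : 0 < n%:R * eta n :> R by rewrite mulr_gt0// eta_gt0.
have PF : P (X 0 @^-1` `]-oo, x]) = (density_cdf f x)%:E.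
  by rewrite -density_cdfE// -(iidX.2 0%N).
apply: le_trans (sample_count_deviation iidX n t0 PF) _.
rewrite lee_fin exprMn eta_sqr// le_eqVlt; apply/orP; left; apply/eqP.
by field; rewrite !gt_eqF// (lt_le_trans _ l1).
Qed.

End sample_is_good.

(** * The band is uniformly close to the density *)

Section band_close.
Context {R : realType}.

Lemma expR_close (lam r t : R) : `|r - lam| <= t -> t <= 2^-1 ->
  `|expR r - expR lam| <= 2 * expR lam * t.
Proof.
rewrite ler_distl => /andP[r1 r2] t2.
have -> : expR r = expR lam * expR (r - lam) by rewrite -expRD addrC subrK.
rewrite -{2}(mulr1 (expR lam)) -mulrBr normrM (gtr0_norm (expR_gt0 _)).
rewrite -[leRHS]mulrA [leRHS]mulrCA ler_pM2l ?expR_gt0//.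
have h1 : 1 - t <= expR (r - lam).
  by apply: le_trans (expR_ge1Dx _); lra.
have h2 : expR (r - lam) <= 1 + 2 * t.
  apply: (@le_trans _ _ (expR t)); first by rewrite ler_expR; lra.
  have h3 : 1 - t <= expR (- t) by exact: expR_ge1Dx.
  rewrite -[leLHS]invrK -expRN; apply: (@le_trans _ _ (1 - t)^-1).
    by rewrite lef_pV2// posrE ?expR_gt0//; lra.
  by rewrite -[leLHS]mul1r ler_pdivrMr; nra.
by rewrite ler_norml; apply/andP; split; lra.
Qed.

Variables (alpha : R) (f : R -> R) (a0 a b b0 p q : R) (K : nat).
Hypotheses (alpha01 : 0 < alpha < 1) (f_density : is_density f).
Hypotheses (a0a : a0 < a) (ab : a <= b) (bb0 : b < b0).
Hypothesis f_aff : forall x, a0 <= x <= b0 -> f x = expR (p * x + q).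
Hypothesis K4 : (4 <= K)%N.
Local Notation G := (density_cdf f).
Hypothesis left_mass : 10 / 2 ^+ K <= G a - G a0.
Hypothesis right_mass : 10 / 2 ^+ K <= G b0 - G b.

Let ab0 : a0 < b0. Proof. exact: lt_trans a0a (le_lt_trans ab bb0). Qed.

Let D : R := band_const a0 b0 p q K.

Definition close_const : R := 2 * expR (log_max a0 b0 p q) * D.

Lemma good_sample_close (xs : seq R) : uniq xs ->
  let n := size xs in
  1 <= ln (ln n%:R : R) -> ln n%:R <= n%:R / 2 ^+ K.+1 :> R ->
  2 ^+ (K + 6) / alpha < ln n%:R :> R ->
  eta n <= (10 * 2 ^+ K.+1)^-1 :> R -> D * eta n <= 2^-1 ->
  (forall r, (r < 2 ^ K.+1)%N ->
    let v := r%:R * ((coarse_size K n)%:R / n%:R) in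
    G a0 <= v - eta n -> v + eta n <= G b0 ->
    [/\ a0 <= order_stat xs (1 + r * coarse_size K n) <= b0,
      v - eta n <= G (order_stat xs (1 + r * coarse_size K n)) &
      G (order_stat xs (1 + r * coarse_size K n)) <= v + eta n]) ->
  band_exists alpha xs -> forall x, a <= x <= b -> exists r r' : R,
  [/\ muhat alpha xs x = r%:E, lhat alpha xs x = r'%:E,
      `|expR r - f x| <= close_const * eta n &
      `|expR r' - f x| <= close_const * eta n].
Proof.
move=> uxs n l1 l2 l3 e1 e2 good ex x xab.
have [r [r' [-> -> rx r'x]]] := good_sample_band alpha01 f_density a0a ab bb0
  f_aff K4 left_mass right_mass l1 l2 l3 e1 uxs good ex xab.
have x0 : a0 <= x <= b0.
  case/andP: xab => ax xb.
  by rewrite (le_trans (ltW a0a) ax) (le_trans xb (ltW bb0)).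
have De0 : 0 <= D * eta n by apply: le_trans rx.
have lift u : `|u - (p * x + q)| <= D * eta n ->
    `|expR u - f x| <= close_const * eta n.
  move=> ux; rewrite f_aff//; apply: le_trans (expR_close ux e2) _.
  rewrite /close_const -[leRHS]mulrA ler_wpM2r// ler_pM2l//.
  by rewrite ler_expR lam_le_max.
by exists r, r'; split => //; exact: lift.
Qed.

Section sampling.
Context d (T : measurableType d) (P : probability T R).
Variable X : nat -> {RV P >-> R}.
Hypothesis iidX : iid_with_density f X.

(** If the counts at the quantiles v - eta and v + eta are right up to n * eta,
    they enclose r * N, and the order statistic of rank 1 + r * N is trapped
    between these two quantiles. *)
Lemma sample_quantiles (h : R -> R) n w r :
  (forall v, G a0 <= v <= G b0 -> a0 <= h v <= b0 /\ G (h v) = v) ->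
  0 < n%:R :> R -> 0 < eta n :> R ->
  let N := coarse_size K n in
  let v := r%:R * (N%:R / n%:R) in
  ~ count_deviates f X n (h (v - eta n)) w ->
  ~ count_deviates f X n (h (v + eta n)) w ->
  G a0 <= v - eta n -> v + eta n <= G b0 ->
  [/\ a0 <= order_stat (sample X n w) (1 + r * N) <= b0,
      v - eta n <= G (order_stat (sample X n w) (1 + r * N)) &
      G (order_stat (sample X n w) (1 + r * N)) <= v + eta n].
Proof.
move=> hP n0 e0 N v /negP + /negP + va vb; rewrite -!ltNge.
have vm : G a0 <= v - eta n <= G b0 by apply/andP; split => //; lra.
have vp : G a0 <= v + eta n <= G b0 by apply/andP; split => //; lra.
have [/andP[am bm] Gm] := hP _ vm; have [/andP[ap bp] Gp] := hP _ vp.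
rewrite Gm Gp; set cm := count _ _; set cp := count _ _ => dm dp.
have nv : n%:R * v = (r * N)%:R.
  by rewrite /v natrM mulrCA [n%:R * _]mulrC divfK// gt_eqF.
have cmN : (cm < 1 + r * N)%N.
  rewrite add1n ltnS -(ler_nat R) -nv.
  by move: dm; rewrite ltr_norml => /andP[_]; lra.
have cpN : (1 + r * N <= cp)%N.
  rewrite add1n -(ltr_nat R) -nv.
  by move: dp; rewrite ltr_norml => /andP[+ _]; lra.
have sz : (0 < 1 + r * N <= size (sample X n w))%N.
  by rewrite add1n/=; apply: leq_trans cpN (count_size _ _).
set os := order_stat _ _.
have osm : h (v - eta n) < os by rewrite ltNge order_stat_le// -ltnNge.
have osp : os <= h (v + eta n) by rewrite order_stat_le.
split.
- by rewrite (le_trans am (ltW osm)) (le_trans osp bp).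
- by rewrite -[leLHS]Gm; exact/density_cdf_mono/ltW.
- by rewrite -[leRHS]Gp; exact: density_cdf_mono.
Qed.

(** The exceptional set: a null set of samples with ties, and two deviation
    events for each of the 2 ^ K.+1 possible blocks.  Their number does not
    depend on n. *)
Lemma band_close_whp : \forall n \near \oo,
  exists2 A : set T, measurable A /\
    ~` A `<=` [set w | band_exists alpha (sample X n w) ->
      forall x, a <= x <= b -> exists r r' : R,
      [/\ muhat alpha (sample X n w) x = r%:E, lhat alpha (sample X n w) x = r'%:E,
      `|expR r - f x| <= close_const * eta n &
      `|expR r' - f x| <= close_const * eta n]] &
   (P A <= (2 ^+ K.+1 / 2 / ln (ln n%:R))%:E)%E.
Proof.
have [N0 [mN0 PN0 N0P]] := sample_uniq_ae iidX.
have quantile v : exists u, G a0 <= v <= G b0 -> a0 <= u <= b0 /\ G u = v.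
  have [vab|vab] := boolP (G a0 <= v <= G b0); last by exists 0.
  by have [u uab Gu] := density_quantile f_density ab0 vab; exists u.
have [h hP] := choice quantile.
near=> n.
have A1 : Num.max 1 (2 ^+ (K + 6) / alpha) <= ln (ln (n%:R : R)).
  by near: n; exact: lnln_large.
have l1 : 1 <= ln (ln n%:R : R) by apply: le_trans A1; rewrite le_max lexx.
have lnn0 : 0 < ln (n%:R : R).
  by rewrite ltNge; apply/negP => /ln0 E; move: l1; rewrite E; lra.
have n0 : 0 < n%:R :> R.
  by rewrite ltNge; apply/negP => /ln0 E; move: lnn0; rewrite E; lra.
have l3 : 2 ^+ (K + 6) / alpha < ln (n%:R : R).
  by apply: le_lt_trans (ln_sublinear lnn0); apply: le_trans A1; rewrite le_max lexx orbT.
have l2 : ln n%:R <= n%:R / 2 ^+ K.+1 :> R.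
  rewrite mulrC; near: n; apply: ln_negligible.
  by rewrite invr_gt0 exprn_gt0.
have e1 : eta n <= (10 * 2 ^+ K.+1)^-1 :> R.
  near: n; apply: eta_vanishes.
  by rewrite invr_gt0 mulr_gt0 ?exprn_gt0.
have e2 : D * eta n <= 2^-1.
  have h1 : eta n <= (2 * (`|D| + 1))^-1 :> R.
    near: n; apply: eta_vanishes.
    by rewrite invr_gt0 mulr_gt0// ltr_pwDr.
  have D1 : 0 < `|D| + 1 by rewrite ltr_pwDr.
  apply: (@le_trans _ _ ((`|D| + 1) * eta n)).
    rewrite ler_wpM2r ?sqrtr_ge0// (le_trans (ler_norm D))// lerDl ler01//.
  apply: le_trans (ler_wpM2l (ltW D1) h1) _.
  by rewrite invfM mulrCA divff ?mulr1// gt_eqF.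
pose N := coarse_size K n.
pose v r : R := r%:R * (N%:R / n%:R).
pose Dev r := count_deviates f X n (h (v r - eta n)) `|`
              count_deviates f X n (h (v r + eta n)).
have mDev r : measurable (Dev r).
  by apply: measurableU; exact: measurable_count_deviates.
have PDev r : (P (Dev r) <= (2^-1 / ln (ln n%:R))%:E)%E.
  apply: le_trans (measureU2 P _ _) _; [exact: measurable_count_deviates..|].
  have -> : 2^-1 / ln (ln n%:R) = 4^-1 / ln (ln n%:R) + 4^-1 / ln (ln n%:R) :> R.
    by rewrite -mulrDl; congr (_ / _); lra.
  by rewrite EFinD leeD//; exact: count_deviates_small.
exists (N0 `|` \big[setU/set0]_(r < 2 ^ K.+1) Dev r).
  split.
    by apply: measurableU => //; apply: bigsetU_measurable.
  move=> w; rewrite setCU => -[wN0 wDev] /= ex x xab.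
  have sz : size (sample X n w) = n by rewrite size_mkseq.
  have uxs : uniq (sample X n w).
    by apply: contrapT => nu; apply: wN0; apply: N0P => /= /(_ n).
  have good r : (r < 2 ^ K.+1)%N ->
      G a0 <= v r - eta n -> v r + eta n <= G b0 ->
    [/\ a0 <= order_stat (sample X n w) (1 + r * N) <= b0,
      v r - eta n <= G (order_stat (sample X n w) (1 + r * N)) &
      G (order_stat (sample X n w) (1 + r * N)) <= v r + eta n].
    move=> rK; have wr : ~ Dev r w.
      by move=> Dw; apply: wDev; rewrite -bigcup_mkord; exists r.
    apply: (sample_quantiles hP) => //; first exact: eta_gt0.
      by move=> c; apply: wr; left.
    by move=> c; apply: wr; right.
  have := good_sample_close uxs; rewrite sz.
  by move=> /(_ l1 l2 l3 e1 e2 good ex x xab).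
have mDevU : measurable (\big[setU/set0]_(r < 2 ^ K.+1) Dev r).
  exact: bigsetU_measurable.
have PN0' : (P N0 <= 0)%E by rewrite PN0.
apply: le_trans (measureU2 P mN0 mDevU) _.
apply: le_trans (leeD PN0' (measure_bigcup_le _ mDev PDev)) _.
by rewrite add0e natrX mulrA.
Unshelve. all: by end_near. Qed.

End sampling.
End band_close.

Theorem theorem1 (R : realType) (alpha : R) (alpha01 : 0 < alpha < 1)
    (f : R -> R) (f_density : is_density f) (f_lc : log_concave f)
    (J : set R) (J_itv : is_interval J) (f_aff : log_affine_on J f)
    (a b : R) (ab : a <= b) (IJ : `[a, b] `<=` interior J) :
  exists C : R,
    forall (d : measure_display) (T : measurableType d) (P : probability T R)
      (X : nat -> {RV P >-> R}),
    iid_with_density f X ->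
    [/\ with_prob_tending_to_1 P (fun n => [set w |
          band_exists alpha (sample X n w) ->
          (ereal_sup [set `|expeR (muhat alpha (sample X n w) x) - (f x)%:E|
                     | x in `[a, b]]
           <= (C * Num.sqrt (ln (ln n%:R) / n%:R))%:E)%E]),
        with_prob_tending_to_1 P (fun n => [set w |
          band_exists alpha (sample X n w) ->
          (ereal_sup [set `|expeR (lhat alpha (sample X n w) x) - (f x)%:E|
                     | x in `[a, b]]
           <= (C * Num.sqrt (ln (ln n%:R) / n%:R))%:E)%E]) &
        with_prob_tending_to_1 P (fun n => [set w |
          band_exists alpha (sample X n w) ->
          (ereal_sup [set expeR (muhat alpha (sample X n w) x)
                          - expeR (lhat alpha (sample X n w) x)
                     | x in `[a, b]]
           <= (2 * C * Num.sqrt (ln (ln n%:R) / n%:R))%:E)%E])].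
Proof.
have [p [q Jpq]] := f_aff.
have fJ x : J x -> f x = expR (p * x + q).
  move=> Jx; case: f_density => _ f0 _.
  have E : expeR (lne (f x)%:E) = (f x)%:E.
    by rewrite lneK// in_itv/= lee_fin f0 leey.
  by rewrite Jpq// in E; case: E.
(* Room on both sides of [a, b] inside J, for the outer blocks. *)
have int_left : exists2 a0, a0 < a & J a0.
  have : (interior J) a by apply: IJ; rewrite /= in_itv/= lexx.
  move=> /nbhs_ballP[e /= e0 eJ]; exists (a - e / 2).
    by rewrite ltrBlDr ltrDl divr_gt0.
  apply: eJ; rewrite /ball/= opprB addrC subrK ger0_norm ?divr_ge0 ?ltW//.
  by rewrite ltr_pdivrMr// ltr_pMr// ltr1n.
have int_right : exists2 b0, b < b0 & J b0.
  have : (interior J) b by apply: IJ; rewrite /= in_itv/= lexx andbT.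
  move=> /nbhs_ballP[e /= e0 eJ]; exists (b + e / 2).
    by rewrite ltrDl divr_gt0.
  apply: eJ; rewrite /ball/= opprD addrA subrr sub0r normrN ger0_norm ?divr_ge0 ?ltW//.
  by rewrite ltr_pdivrMr// ltr_pMr// ltr1n.
have [a0 a0a Ja0] := int_left; have [b0 bb0 Jb0] := int_right.
have ab0 : a0 < b0 by exact: lt_trans a0a (le_lt_trans ab bb0).
have f_aff' x : a0 <= x <= b0 -> f x = expR (p * x + q).
  by move=> xab; apply: fJ; exact: (J_itv a0 b0).
pose G := density_cdf f.
have Ga : 0 < G a - G a0.
  rewrite subr_gt0; apply: (density_cdf_lt f_density f_aff') => //.
  exact: le_trans ab (ltW bb0).
have Gb : 0 < G b0 - G b.
  rewrite subr_gt0; apply: (density_cdf_lt f_density f_aff') => //.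
  exact: le_trans (ltW a0a) ab.
pose m := Num.min (G a - G a0) (G b0 - G b).
have m0 : 0 < m by rewrite lt_min Ga.
pose K := (Num.bound (10 / m) + 4)%N.
have K4 : (4 <= K)%N by rewrite leq_addl.
have Km : 10 / 2 ^+ K <= m.
  rewrite ler_pdivrMr ?exprn_gt0// mulrC -ler_pdivrMr//.
  apply: (@le_trans _ _ (Num.bound (10 / m))%:R).
    by rewrite ltW// archi_boundP// divr_ge0// ltW.
  rewrite -natrX ler_nat; apply: leq_trans (ltnW (ltn_expl _ (isT : 1 < 2)%N)).
  by rewrite leq_addr.
have left_mass : 10 / 2 ^+ K <= G a - G a0 by apply: le_trans Km _; rewrite ge_min lexx.
have right_mass : 10 / 2 ^+ K <= G b0 - G b by apply: le_trans Km _; rewrite ge_min lexx orbT.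
exists (close_const a0 b0 p q K) => d T P X iidX.
have close := band_close_whp alpha01 f_density a0a ab bb0 f_aff' K4 left_mass
  right_mass iidX.
split; apply: (with_prob_tending_to_1_lnln (c := 2 ^+ K.+1 / 2));
  apply: filterS close => n [A [mA AE] PA];
  exists A => //; split => // w /AE/= H /H {}H; apply: ge_ereal_sup => _ [x /= xab <-];
  rewrite in_itv/= in xab; have [r [r' [muE lE rx r'x]]] := H _ xab;
  rewrite ?muE ?lE.
- by rewrite lee_fin.
- by rewrite lee_fin.
rewrite lee_fin -mulrA mulr_natl mulr2n.
have -> : expR r - expR r' = (expR r - f x) + (f x - expR r') by rewrite addrA subrK.
apply: lerD; first exact: le_trans (ler_norm _) rx.
by apply: le_trans (ler_norm _) _; rewrite distrC.
Qed.
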